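(* The symmetric moment problem given by $b_n(c)=c^c(n+1)^c$, $n\ge0$, has property (cs* ) when $c>3/2$; that is, $\sum_{l=0}^\infty c_l|s_{l+m}|<\infty$ for all $m\ge0$.
   Context: Given positive numbers $(b_n)_{n\ge0}$, let $P_{-1}=0$, $P_0=1$ and $xP_n(x)=b_nP_{n+1}(x)+b_{n-1}P_{n-1}(x)$, $n\ge0$ (the value of $b_{-1}$ is irrelevant). There is a probability measure $\mu$ on $\mathbb{R}$ with infinite support and all moments for which $(P_n)$ are the orthonormal polynomials; its moments $s_n=\int x^n\,d\mu$ depend only on $(b_n)$ (and vanish for odd $n$). The associated Hamburger moment problem is the symmetric moment problem given by $(b_n)$; it is indeterminate if more than one measure has the moments $(s_n)$. For $b_n=c^c(n+1)^c$ with $c>1$ it is known to be indeterminate. Write $P_n(x)=\sum_{k=0}^n b_{k,n}x^k$. In the indeterminate case put $c_k=\big(\sum_{n=k}^\infty b_{k,n}^2\big)^{1/2}<\infty$. *)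

(* Defs.v *)
From HB Require Import structures.
From mathcomp Require Import all_boot all_order all_algebra.
From mathcomp Require Import all_classical all_reals all_analysis.
Set Implicit Arguments.
Unset Strict Implicit.
Unset Printing Implicit Defensive.
Import Order.TTheory GRing.Theory Num.Theory.
Local Open Scope ring_scope.

Section SymmetricMomentProblem.
Context {R : realType}.
Implicit Types (b : nat -> R) (mu : probability (measurableTypeR R) R).

(* The pair (P_{n-1}, P_n), starting from (P_{-1}, P_0) = (0, 1). In the step
   n = 0, b (0.-1) = b 0 stands for the irrelevant b_{-1}, as it multiplies
   P_{-1} = 0. *)
Fixpoint orthopoly_pair b (n : nat) : {poly R} * {poly R} :=
  if n is n'.+1 then
    let: (p, q) := orthopoly_pair b n' in
    (q, (b n')^-1 *: ('X * q - b n'.-1 *: p))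
  else (0, 1).

Definition orthopoly b (n : nat) : {poly R} := (orthopoly_pair b n).2.

Lemma orthopoly0 b : orthopoly b 0 = 1.
Proof. by []. Qed.

Lemma orthopoly_rec0 b : b 0%N != 0 ->
  'X * orthopoly b 0 = b 0%N *: orthopoly b 1.
Proof.
move=> b0; rewrite /orthopoly /= scaler0 subr0.
by rewrite scalerA mulfV// scale1r.
Qed.

Lemma orthopoly_recS b n : b n.+1 != 0 ->
  'X * orthopoly b n.+1 =
    b n.+1 *: orthopoly b n.+2 + b n *: orthopoly b n.
Proof.
rewrite /orthopoly /=; case: (orthopoly_pair b n) => p q /= bn.
by rewrite scalerA mulfV// scale1r subrK.
Qed.

Definition moment mu (n : nat) : R := \int[mu]_x (x ^+ n).

(* mu has all moments and (P_n) is orthonormal in L^2(mu). Since the P_n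
   are infinitely many, the support of mu is then automatically infinite. *)
Definition orthonormal_measure b mu : Prop :=
  (forall n : nat, mu.-integrable setT (fun x : R => (x ^+ n)%:E)) /\
  (forall i j : nat,
     \int[mu]_x ((orthopoly b i).[x] * (orthopoly b j).[x]) = (i == j)%:R).

(* c_k = (sum_{n >= k} b_{k,n}^2)^{1/2}, with value +oo if the series
   diverges. *)
Definition coef_norm b (k : nat) : \bar R :=
  sqrte (\sum_(k <= n <oo) (((orthopoly b n)`_k) ^+ 2)%:E)%E.

(* The moments s_n depend only on b, so all representing measures mu give the
   same series. The cases m = 0, 1 force every c_l to be finite, because the
   moments of even order are positive. *)
Definition property_cs_star b : Prop :=
  forall mu, orthonormal_measure b mu ->
  forall m : nat,
    (\sum_(0 <= l <oo) (coef_norm b l * `|moment mu (l + m)|%:E) < +oo)%E.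

Definition power_coef (c : R) (n : nat) : R := c `^ c * n.+1%:R `^ c.

End SymmetricMomentProblem.

(* Main.v *)
Require Import Defs.
From mathcomp Require Import all_boot all_order all_algebra.
From mathcomp Require Import all_classical all_reals all_analysis.
From mathcomp Require Import measurable_realfun zify ring lra.
Set Implicit Arguments.
Unset Strict Implicit.
Unset Printing Implicit Defensive.
Import Order.TTheory GRing.Theory Num.Theory.
Import numFieldNormedType.Exports.
Local Open Scope classical_set_scope.
Local Open Scope ring_scope.

(** Put [b_n = (c (n + 1))^c], [x = 2 (c kap)^c], so that [x / (2 b_n)] is
    [(kap / (n + 1))^c]. The absolute values of the coefficients of [P_n] obey
    the recurrence with all signs positive, so that [c_l x^l] is, up to powers of
    [kap], at most the product of the [exp (arcsinh ((kap / j)^c))] over all [j];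
    while [|P_K (x)|] is at least the product of the [exp (arccosh ((kap / j)^c))]
    over [j <= K], for [K < kap]. Comparing sums with integrals and integrating by
    parts, the logarithms of the two bounds are to leading order [kap] times
    [c * int_0^oo (1 + t^(2c))^(-1/2) dt] and [c * int_0^1 (1 - t^(2c))^(-1/2) dt].
    For [2c = 3] the first integral is exactly twice the second, by the duplication
    formula on the elliptic curve [y^2 = x^3 + 1]; for [2c > 3] the substitution
    [t = v^(3/(2c))] makes it less than twice the second. Hence
    [P_K (x) ^ 2] outgrows [c_l (lam x)^l] for some [lam > 1], so that
    [sum_l c_l |x|^(l+m)] is dominated by a multiple of
    [sum_k (k + 1)^(-2) P_k(x)^2], and the integral of the latter is
    [sum_k (k + 1)^(-2)]. *)

(** * Mean value inequalities and integrals with a variable upper limit *)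

Section Calculus.
Context {R : realType}.
Implicit Types (f df : R -> R) (a b x y s t : R).

Lemma is_derive_le f df x y : (forall t, x <= t -> t <= y -> is_derive t 1 f (df t)) ->
  (forall t, x <= t -> t <= y -> 0 <= df t) -> x <= y -> f x <= f y.
Proof.
move=> fdf df0 xy.
have Do t : t \in `]x, y[ -> is_derive t 1 f (df t).
  by rewrite in_itv/= => /andP[/ltW xt /ltW ty]; exact: fdf.
have cf : {within `[x, y], continuous f}.
  apply: continuous_in_subspaceT => t; rewrite inE/= in_itv/= => /andP[xt ty].
  by have := fdf t xt ty => Dt; apply/differentiable_continuous/derivable1_diffP.
have [t tI E] := @MVT_segment R f df x y xy Do cf.
rewrite -subr_ge0 E mulr_ge0 ?subr_ge0//.
by move: tI; rewrite in_itv/= => /andP[xt ty]; exact: df0.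
Qed.

Lemma is_derive_subr_le f df k x y :
  (forall t, x <= t -> t <= y -> is_derive t 1 f (df t)) ->
  (forall t, x <= t -> t <= y -> df t <= k) -> x <= y -> f y - f x <= k * (y - x).
Proof.
move=> fdf dfk xy.
suff : k * x - f x <= k * y - f y by lra.
apply: (@is_derive_le (fun t => k * t - f t) (fun t => k - df t)) => // t xt ty.
  have ? := fdf t xt ty.
  by apply: is_derive_eq; rewrite -[_ *: _]/(_ * _) mulr1.
by rewrite subr_ge0 dfk.
Qed.

Lemma is_derive_subr_ge f df k x y :
  (forall t, x <= t -> t <= y -> is_derive t 1 f (df t)) ->
  (forall t, x <= t -> t <= y -> k <= df t) -> x <= y -> k * (y - x) <= f y - f x.
Proof.
move=> fdf dfk xy.
suff : - f y - - f x <= - k * (y - x) by lra.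
apply: (@is_derive_subr_le (fun t => - f t) (fun t => - df t)) => // t xt ty.
  by have ? := fdf t xt ty; exact: is_deriveN.
by rewrite lerN2 dfk.
Qed.

Local Notation mu := (@lebesgue_measure R).

Definition primitive f x : R := \int[mu]_(t in `[0, x]) f t.

Lemma bounded_itv_integrable f b M : measurable_fun setT f ->
  (forall t, 0 <= t -> t <= b -> `|f t| <= M) ->
  mu.-integrable `[0, b] (EFin \o f).
Proof.
move=> mf fM; apply: measurable_bounded_integrable => //.
- by rewrite /= lebesgue_measure_itv/=; case: ifP => // _; rewrite -EFinB ltry.
- exact: measurable_funS mf.
- exists M; split; first exact: num_real.
  move=> N MN t; rewrite /= in_itv/= => /andP[t0 tb].
  exact: le_trans (fM t t0 tb) (ltW MN).
Qed.

Lemma is_derive_primitive f b M x : measurable_fun setT f ->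
  (forall t, 0 <= t -> t <= b -> `|f t| <= M) -> 0 < x -> x < b ->
  {for x, continuous f} -> is_derive x 1 (primitive f) (f x).
Proof.
move=> mf fM x0 xb cf.
have [d e] := @continuous_FTC1_closed R f 0 x b xb
  (bounded_itv_integrable mf fM) x0 cf.
apply: DeriveDef; first exact: d.
by rewrite -derive1E; exact: e.
Qed.

Lemma primitive_ge0 f b : (forall t, 0 <= t -> t <= b -> 0 <= f t) ->
  0 <= primitive f b.
Proof.
by move=> f0; apply: Rintegral_ge0 => t; rewrite /= in_itv/= => /andP[]; exact: f0.
Qed.

Lemma primitive_le f b M : measurable_fun setT f -> 0 <= b ->
  (forall t, 0 <= t -> t <= b -> `|f t| <= M) -> primitive f b <= M * b.
Proof.
move=> mf b0 fM.
have -> : M * b = \int[mu]_(t in `[0, b]) (cst M t).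
  rewrite Rintegral_cst//= lebesgue_measure_itv/= lte_fin.
  by case: ltP => [|b0']; [rewrite oppr0 addr0|rewrite (@le_anti _ _ b 0) ?b0' ?b0].
apply: le_Rintegral => //.
- exact: bounded_itv_integrable fM.
- by apply: (@bounded_itv_integrable _ _ `|M|) => // *; exact: measurable_cst.
- move=> t; rewrite /= in_itv/= => /andP[t0 tb].
  exact: le_trans (ler_norm _) (fM t t0 tb).
Qed.

End Calculus.

(** * The inverse hyperbolic functions behind both bounds, their derivatives and primitives *)

Section ArcFunctions.
Context {R : realType}.
Implicit Types (e c s t : R).

Definition radicand e c s := 1 + e * (s `^ c) ^+ 2.

(** Written as a real power, so that continuity and measurability come from those of [powR]; [kernE]
    returns to the inverse square root. *)
Definition kern e c s := (radicand e c s) `^ (- 2^-1).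

(* [exp (arc e c s)] is [w + sqrt (w ^ 2 + e)] for [w = s^(-c)]: thus
   [arc 1 c s] is [arcsinh (s^(-c))] and [arc (-1) c s] is [arccosh (s^(-c))]. *)
Definition arc e c s := ln (1 + Num.sqrt (radicand e c s)) - c * ln s.

Definition arc_prim e c s := s * arc e c s + c * primitive (kern e c) s.

Lemma kernE e c s : 0 <= radicand e c s ->
  kern e c s = (Num.sqrt (radicand e c s))^-1.
Proof. by move=> r0; rewrite /kern powRN powR12_sqrt. Qed.

Lemma is_derive_radicand e c s : 0 < s ->
  is_derive s 1 (radicand e c) (2 * c * e * (s `^ c) ^+ 2 / s).
Proof.
move=> s0; have ? := is_derive1_powR c s0.
apply: is_derive_eq.
rewrite powRB ?(gt_eqF s0) ?implybT// powRr1 ?ltW//.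
rewrite -![_ *: _]/(_ * _) /=.
field.
by rewrite gt_eqF.
Qed.

Lemma is_derive_arc e c s : 0 < s -> 0 < radicand e c s ->
  is_derive s 1 (arc e c) (- c / (s * Num.sqrt (radicand e c s))).
Proof.
move=> s0 r0; have d1 := is_derive_radicand e c s0.
have q0 : 0 < Num.sqrt (radicand e c s) by rewrite sqrtr_gt0.
have q1 : 0 < 1 + Num.sqrt (radicand e c s) by rewrite addr_gt0.
have d2 := @is_derive1_comp R Num.sqrt (radicand e c) s _ _ (is_derive1_sqrt r0) d1.
have d3 : is_derive s 1 (fun s => 1 + Num.sqrt (radicand e c s))
    ((2 * Num.sqrt (radicand e c s))^-1 * (2 * c * e * (s `^ c) ^+ 2 / s)).
  by have := is_deriveD (is_derive_cst (1 : R) s 1) d2; rewrite add0r.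
have d4 := @is_derive1_comp R (@ln R) _ s _ _ (is_derive1_ln q1) d3.
have d5 := is_derive1_ln s0.
have d6 := is_deriveB d4 (is_deriveZ c d5).
apply: (is_derive_eq d6).
rewrite -![_ *: _]/(_ * _) /=.
(* With [q] the square root of the radicand, the numerator becomes a multiple of
   [(q - 1) * (q + 1)], which cancels the denominator [1 + q] left by the logarithm. *)
have E : e * (s `^ c) ^+ 2 = (Num.sqrt (radicand e c s)) ^+ 2 - 1.
  by rewrite sqr_sqrtr ?ltW// /radicand addrC addKr.
rewrite -(mulrA (2 * c)) E.
by field; rewrite !gt_eqF.
Qed.

Lemma kern_continuous e c s : 0 < s -> 0 < radicand e c s ->
  {for s, continuous (kern e c)}.
Proof.
move=> s0 r0; have d1 := is_derive_radicand e c s0.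
have d2 := @is_derive1_comp R (@powR R ^~ (- 2^-1)) (radicand e c) s _ _
  (is_derive1_powR (- 2^-1) r0) d1.
by apply/differentiable_continuous/derivable1_diffP; case: d2.
Qed.

Lemma measurable_kern e c : measurable_fun setT (kern e c).
Proof.
apply: (measurableT_comp (measurable_powR _)).
apply: measurable_funD => //; apply: measurable_funM => //.
apply: measurable_funX; exact: measurable_powR.
Qed.

(** Integration by parts: [s] times the derivative of [arc e c] is [- c * kern e c s], which the
    second summand of [arc_prim] cancels. *)
Lemma is_derive_arc_prim e c b M s : (forall t, 0 <= t -> t <= b -> `|kern e c t| <= M) ->
  0 < s -> s < b -> 0 < radicand e c s ->
  is_derive s 1 (arc_prim e c) (arc e c s).
Proof.
move=> kM s0 sb r0.
have d1 := is_derive_primitive (measurable_kern e c) kM s0 sb (kern_continuous s0 r0).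
have d2 := is_derive_arc s0 r0.
have d3 := is_deriveD (is_deriveM (is_derive_id s (1 : R)) d2) (is_deriveZ c d1).
apply: (is_derive_eq d3).
rewrite -![_ *: _]/(_ * _) /= kernE ?ltW//; field.
by rewrite !gt_eqF// sqrtr_gt0.
Qed.

(** With [q] the square root of the radicand, [(q - 1) * (q + 1) = e * s^(2c)] turns
    [e * s^c / (1 + q)] into [(q - 1) / s^c]. At [s = (n + 1) / kap] the right-hand side is
    [x / b_n], so [expR (arc e c s)] solves the characteristic equation of the recurrence with
    frozen coefficients, with the signs made positive when [e = 1]. *)
Lemma expR_arc e c s : 0 < s -> 0 <= radicand e c s ->
  expR (arc e c s) - e * expR (- arc e c s) = 2 * (s `^ c)^-1.
Proof.
move=> s0 r0; have p0 : 0 < s `^ c by apply: powR_gt0.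
have q1 : 0 < 1 + Num.sqrt (radicand e c s) by rewrite ltr_pwDl// sqrtr_ge0.
have E : expR (arc e c s) = (1 + Num.sqrt (radicand e c s)) / s `^ c.
  by rewrite /arc expRB lnK// [s `^ c]/powR (gt_eqF s0).
rewrite expRN E invf_div.
have H : e * (s `^ c) ^+ 2 = (Num.sqrt (radicand e c s)) ^+ 2 - 1.
  by rewrite sqr_sqrtr// /radicand addrC addKr.
suff -> : e * (s `^ c / (1 + Num.sqrt (radicand e c s))) =
   (Num.sqrt (radicand e c s) - 1) / s `^ c.
  by field; rewrite gt_eqF.
apply: (@mulfI _ (s `^ c * (1 + Num.sqrt (radicand e c s)))).
  by rewrite mulf_neq0 ?gt_eqF.
transitivity (e * (s `^ c) ^+ 2); first by field; rewrite gt_eqF.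
by rewrite H; field; rewrite gt_eqF.
Qed.

Lemma arc_ge0 e c s : 0 <= c -> 0 < s -> s <= 1 -> 0 <= arc e c s.
Proof.
move=> c0 s0 s1; rewrite /arc subr_ge0; apply: (@le_trans _ _ 0).
  by rewrite mulr_ge0_le0 ?ln_le0.
by rewrite ln_ge0// lerDl sqrtr_ge0.
Qed.

End ArcFunctions.

(** * Comparison of sums of [arc] over a grid of step [1 / kap] with its primitive *)

Section ArcSums.
Context {R : realType}.
Implicit Types (e c s t b m kap : R).

Lemma ler_radicand1 c t : 1 <= radicand 1 c t.
Proof. by rewrite /radicand lerDl mul1r sqr_ge0. Qed.

(** For [e = -1] the kernel is singular at 1; keeping [t] below some [b < 1] makes the left-hand
    side a positive [m] as the next section requires. *)
Lemma ler_radicandN1 c b t : 0 <= c -> 0 <= t -> t <= b ->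
  1 - (b `^ c) ^+ 2 <= radicand (-1) c t.
Proof.
move=> c0 t0 tb; rewrite /radicand mulN1r lerD2l lerN2 lerXn2r ?nnegrE ?powR_ge0//.
by rewrite ge0_ler_powR// nnegrE// (le_trans t0).
Qed.

Section Bounded.
Context (e c b m : R) (c0 : 0 <= c) (m0 : 0 < m)
  (hm : forall t, 0 <= t -> t <= b -> m <= radicand e c t).

Lemma kern_ge0 s : 0 <= kern e c s.
Proof. exact: powR_ge0. Qed.

Lemma kern_le t : 0 <= t -> t <= b -> kern e c t <= (Num.sqrt m)^-1.
Proof.
move=> t0 tb; have r := hm t0 tb; have r0 := lt_le_trans m0 r.
by rewrite kernE ?lef_pV2 ?posrE ?sqrtr_gt0 ?ler_sqrt// ltW.
Qed.

Lemma normr_kern_le t : 0 <= t -> t <= b -> `|kern e c t| <= (Num.sqrt m)^-1.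
Proof. by move=> *; rewrite ger0_norm ?kern_ge0// kern_le. Qed.

Lemma is_derive_arc_prim_in s : 0 < s -> s < b ->
  is_derive s 1 (arc_prim e c) (arc e c s).
Proof.
move=> s0 sb; apply: (is_derive_arc_prim normr_kern_le) => //.
by apply: lt_le_trans m0 _; apply: hm; exact: ltW.
Qed.

Lemma is_derive_primitive_kern s : 0 < s -> s < b ->
  is_derive s 1 (primitive (kern e c)) (kern e c s).
Proof.
move=> s0 sb; apply: (is_derive_primitive (measurable_kern e c) normr_kern_le s0 sb).
by apply: kern_continuous => //; apply: lt_le_trans m0 _; apply: hm; exact: ltW.
Qed.

Lemma arc_nincr x y : 0 < x -> x <= y -> y <= b -> arc e c y <= arc e c x.
Proof.
move=> x0 xy yb; rewrite -lerN2.
apply: (@is_derive_le R (fun t => - arc e c t)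
  (fun t => - (- c / (t * Num.sqrt (radicand e c t))))) => // t xt ty.
  apply: is_deriveN; apply: is_derive_arc; first exact: lt_le_trans xt.
  by apply: lt_le_trans m0 _; apply: hm; rewrite ?(le_trans ty)// ltW// (lt_le_trans x0).
by rewrite mulNr opprK divr_ge0// mulr_ge0 ?sqrtr_ge0// ltW// (lt_le_trans x0).
Qed.

Lemma arc_prim_subr_le x y : 0 < x -> x <= y -> y < b ->
  arc_prim e c y - arc_prim e c x <= arc e c x * (y - x).
Proof.
move=> x0 xy yb; apply: (@is_derive_subr_le R _ (arc e c)) => // t xt ty.
  apply: is_derive_arc_prim_in; first exact: lt_le_trans xt.
  exact: le_lt_trans yb.
by apply: arc_nincr => //; rewrite (le_trans ty)// ltW.
Qed.

Lemma arc_prim_subr_ge x y : 0 < x -> x <= y -> y < b ->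
  arc e c y * (y - x) <= arc_prim e c y - arc_prim e c x.
Proof.
move=> x0 xy yb; apply: (@is_derive_subr_ge R _ (arc e c)) => // t xt ty.
  apply: is_derive_arc_prim_in; first exact: lt_le_trans xt.
  exact: le_lt_trans yb.
by apply: arc_nincr => //; [exact: lt_le_trans xt|exact: ltW].
Qed.

(** As [arc] decreases, each later term is at most [kap] times the integral over the preceding step.
    The first term stays apart because [arc] is unbounded near 0. *)
Lemma sum_arc_le kap n : 0 < kap -> n.+1%:R / kap < b ->
  \sum_(i < n.+1) arc e c (i.+1%:R / kap) <=
  arc e c (1 / kap) + kap * (arc_prim e c (n.+1%:R / kap) - arc_prim e c (1 / kap)).
Proof.
move=> k0; elim: n => [|n IH] nb.
  by rewrite big_ord_recl big_ord0 /= subrr mulr0 addr0.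
have nn : n.+1%:R / kap <= n.+2%:R / kap by rewrite ler_pM2r ?invr_gt0// ler_nat.
rewrite big_ord_recr /=.
have := IH (le_lt_trans nn nb).
have := arc_prim_subr_ge _ nn nb; rewrite divr_gt0 ?ltr0n// => /(_ isT).
have -> : n.+2%:R / kap - n.+1%:R / kap = kap^-1 by rewrite -mulrBl -natrB// subSnn mul1r.
rewrite ler_pdivrMr// => H1 H2.
lra.
Qed.

(** Here each term is compared with the following step, so [n] terms reach the endpoint
    [(n + 1) / kap]. *)
Lemma sum_arc_ge kap n : 0 < kap -> n.+1%:R / kap < b ->
  kap * (arc_prim e c (n.+1%:R / kap) - arc_prim e c (1 / kap)) <=
  \sum_(i < n) arc e c (i.+1%:R / kap).
Proof.
move=> k0; elim: n => [|n IH] nb.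
  by rewrite big_ord0 subrr mulr0.
have nn : n.+1%:R / kap <= n.+2%:R / kap by rewrite ler_pM2r ?invr_gt0// ler_nat.
rewrite big_ord_recr /=.
have := IH (le_lt_trans nn nb).
have := arc_prim_subr_le _ nn nb; rewrite divr_gt0 ?ltr0n// => /(_ isT).
have -> : n.+2%:R / kap - n.+1%:R / kap = kap^-1 by rewrite -mulrBl -natrB// subSnn mul1r.
rewrite ler_pdivlMr// => H1 H2.
lra.
Qed.

End Bounded.

End ArcSums.

(** * Doubling of points on the curve [y ^ 2 = x ^ 3 + 1] *)

Section EllipticDuplication.
Context {R : realType}.
Implicit Types (c s t v u : R).

(* If [(v, y)] lies on [y ^ 2 = 1 - x ^ 3], then doubling the point [(- v, y)]
   of [y ^ 2 = x ^ 3 + 1] gives a point with abscissa [duplication v]. *)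
Definition duplication v := (v ^+ 4 + 8 * v) / (4 * (1 - v ^+ 3)).

Lemma onem_cube_gt0 v : 0 < v -> v < 1 -> 0 < 1 - v ^+ 3.
Proof. by move=> v0 v1; rewrite subr_gt0 exprn_ilt1// ltW. Qed.

(** The factor 2 is the slope at 0. As [eta - 1] is negative, this bound is what later gives the
    derivative of the gap its sign. *)
Lemma duplication_ge v : 0 < v -> v < 1 -> 2 * v <= duplication v.
Proof.
move=> v0 v1; have q := onem_cube_gt0 v0 v1.
rewrite /duplication ler_pdivlMr ?mulr_gt0//.
have := exprn_gt0 4 v0; rewrite (exprS v 3) => v4.
have -> : 2 * v * (4 * (1 - v ^+ 3)) = 8 * v - 8 * (v * v ^+ 3) by ring.
lra.
Qed.

Lemma duplication_le v : 0 < v -> v <= 2^-1 -> duplication v <= 3 * v.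
Proof.
move=> v0 v1.
have v3 : v ^+ 3 <= 8^-1.
  have -> : 8^-1 = (2^-1) ^+ 3 :> R by field.
  by rewrite lerXn2r ?nnegrE// ltW.
rewrite /duplication ler_pdivrMr; last lra.
have : v * v ^+ 3 <= v * 8^-1 by rewrite ler_pM2l.
rewrite (exprS v 3).
have -> : 3 * v * (4 * (1 - v ^+ 3)) = 12 * v - 12 * (v * v ^+ 3) by ring.
lra.
Qed.

Lemma duplication_ge_inv v : 2^-1 <= v -> v < 1 -> (3 * (1 - v))^-1 <= duplication v.
Proof.
move=> v2 v1; have v0 : 0 < v by lra.
have q := onem_cube_gt0 v0 v1.
have v4 := exprn_gt0 4 v0.
apply: (@le_trans _ _ (1 - v ^+ 3)^-1).
  rewrite lef_pV2 ?posrE//; last lra.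
  have -> : 1 - v ^+ 3 = (1 - v) * (1 + v + v * v) by ring.
  by rewrite [leRHS]mulrC ler_pM2l ?subr_gt0//; nra.
rewrite -[leLHS]mul1r /duplication ler_pdivrMr//.
have -> : (v ^+ 4 + 8 * v) / (4 * (1 - v ^+ 3)) * (1 - v ^+ 3) = (v ^+ 4 + 8 * v) / 4.
  by field; rewrite gt_eqF.
lra.
Qed.

Lemma duplication_num_gt0 v : 0 < v -> v < 1 -> 0 < 8 + 20 * v ^+ 3 - v ^+ 6.
Proof.
move=> v0 v1; have v6 : v ^+ 6 < 1 by rewrite exprn_ilt1// ltW.
by have := exprn_gt0 3 v0; lra.
Qed.

(** The right-hand side is, up to sign, the ordinate of the doubled point. *)
Lemma duplication_cube v : 0 < v -> v < 1 ->
  Num.sqrt (1 + duplication v ^+ 3) =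
  (8 + 20 * v ^+ 3 - v ^+ 6) / (8 * (1 - v ^+ 3) * Num.sqrt (1 - v ^+ 3)).
Proof.
move=> v0 v1; have q := onem_cube_gt0 v0 v1.
have s0 : 0 < Num.sqrt (1 - v ^+ 3) by rewrite sqrtr_gt0.
have E : Num.sqrt (1 - v ^+ 3) ^+ 2 = 1 - v ^+ 3 by rewrite sqr_sqrtr// ltW.
rewrite (_ : 1 + _ = ((8 + 20 * v ^+ 3 - v ^+ 6) /
   (8 * (1 - v ^+ 3) * Num.sqrt (1 - v ^+ 3))) ^+ 2).
  by rewrite sqrtr_sqr ger0_norm// divr_ge0//; [exact/ltW/duplication_num_gt0|rewrite !mulr_ge0// ltW].
rewrite /duplication !expr_div_n !exprMn E; field.
by rewrite gt_eqF.
Qed.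

(** The numerator is that of [duplication_cube]. Dividing by the ordinate there leaves
    [2 / sqrt (1 - v ^ 3)]: doubling a point doubles the invariant differential. *)
Lemma is_derive_duplication v : 0 < v -> v < 1 ->
  is_derive v 1 duplication ((8 + 20 * v ^+ 3 - v ^+ 6) / (4 * (1 - v ^+ 3) ^+ 2)).
Proof.
move=> v0 v1; have q := onem_cube_gt0 v0 v1.
have q4 : 4 * (1 - v ^+ 3) != 0 by rewrite gt_eqF// mulr_gt0.
have dq : is_derive v 1 (fun v : R => 4 * (1 - v ^+ 3)) (- 12 * v ^+ 2).
  by apply: is_derive_eq; rewrite -![_ *: _]/(_ * _) /=; ring.
have dn : is_derive v 1 (fun v : R => v ^+ 4 + 8 * v) (4 * v ^+ 3 + 8).
  by apply: is_derive_eq; rewrite -![_ *: _]/(_ * _) /=; ring.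
have dV := @is_deriveV R (fun v => 4 * (1 - v ^+ 3)) v _ 1 q4 dq.
apply: (is_derive_eq (is_deriveM dn dV)).
rewrite -![_ *: _]/(_ * _) /=; field.
by rewrite gt_eqF.
Qed.

End EllipticDuplication.

(** * The strict inequality between the two constants when [c > 3/2] *)

Section SharpConstant.
Context {R : realType}.
Context (c : R) (hc : 3 / 2 < c).
Implicit Types (s t v u x : R).

Local Notation eta := (3 / (2 * c)).
Local Notation Phi := (primitive (kern 1 c)).
Local Notation Gam := (primitive (kern (-1) c)).

Let c0 : 0 < c. Proof. by apply: lt_trans hc; lra. Qed.

Let eta_gt0 : 0 < eta. Proof. by rewrite divr_gt0// mulr_gt0. Qed.

Let eta_lt1 : eta < 1.
Proof. by rewrite ltr_pdivrMr ?mulr_gt0//; have := hc; lra. Qed.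

Lemma radicand_eta e v : 0 < v -> radicand e c (v `^ eta) = 1 + e * v ^+ 3.
Proof.
move=> v0; rewrite /radicand -powRrM -powR_mulrn ?powR_ge0// -powRrM.
have -> : eta * c * 2%:R = 3%:R by field; rewrite gt_eqF.
by rewrite powR_mulrn// ltW.
Qed.

Lemma le0_ler_powR r x y : r <= 0 -> 0 < x -> x <= y -> y `^ r <= x `^ r.
Proof.
move=> r0 x0 xy; have y0 := lt_le_trans x0 xy.
rewrite -(opprK r) !(powRN _ (- r)) lef_pV2 ?posrE ?powR_gt0//.
by rewrite ge0_ler_powR// ?nnegrE ?oppr_ge0// ltW.
Qed.

Lemma powR_lt1 x r : 0 < r -> 0 <= x -> x < 1 -> x `^ r < 1.
Proof.
move=> r0 x0 x1; have : 1 `^ r = 1 :> R by rewrite powR1.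
by move=> <-; rewrite gt0_ltr_powR// nnegrE.
Qed.

Lemma powR_eta_lt1 v : 0 < v -> v < 1 -> v `^ eta < 1.
Proof. by move=> v0 v1; apply: powR_lt1 => //; exact: ltW. Qed.

Lemma is_derive_Gam s : 0 < s -> s < 1 -> is_derive s 1 Gam (kern (-1) c s).
Proof.
move=> s0 s1; pose b := (1 + s) / 2.
have b0 : 0 < b by rewrite /b; lra.
have b1 : b < 1 by rewrite /b; lra.
apply: (@is_derive_primitive_kern R (-1) c b (1 - (b `^ c) ^+ 2)) => //.
- by rewrite subr_gt0 exprn_ilt1// ?powR_ge0// powR_lt1// ltW.
- by move=> t t0 tb; apply: ler_radicandN1 => //; exact: ltW.
- by rewrite /b; lra.
Qed.

Lemma is_derive_Phi s : 0 < s -> is_derive s 1 Phi (kern 1 c s).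
Proof.
move=> s0; apply: (@is_derive_primitive_kern R 1 c (s + 1) 1) => //.
- by move=> *; exact: ler_radicand1.
- by rewrite ltrDl.
Qed.

(** The substitution [t = v^eta] turns [t^(2c)] into [v^3], and the two upper limits are linked by
    doubling. With exponent 1 in place of [eta] the derivative below would vanish. *)
Definition elliptic_gap v := 2 * Gam (v `^ eta) - Phi (duplication v `^ eta).

(** By duplication both integrals contribute the same factor [2 * eta / sqrt (1 - v ^ 3)]; only the
    Jacobian factors, powers with exponent [eta - 1], differ. *)
Lemma is_derive_elliptic_gap v : 0 < v -> v < 1 ->
  is_derive v 1 elliptic_gap (2 * eta / Num.sqrt (1 - v ^+ 3) *
    (v `^ (eta - 1) - duplication v `^ (eta - 1))).
Proof.
move=> v0 v1; have q0 := onem_cube_gt0 v0 v1.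
have D0 : 0 < duplication v.
  by apply: lt_le_trans (duplication_ge v0 v1); rewrite mulr_gt0.
have d1 := is_derive1_powR eta v0.
have w0 : 0 < v `^ eta by exact: powR_gt0.
have d2 := @is_derive1_comp R Gam _ v _ _
  (is_derive_Gam w0 (powR_eta_lt1 v0 v1)) d1.
have d3 := @is_derive1_comp R (@powR R ^~ eta) duplication v _ _
  (is_derive1_powR eta D0) (is_derive_duplication v0 v1).
have d4 := @is_derive1_comp R Phi (@powR R ^~ eta \o duplication) v _ _
  (is_derive_Phi (powR_gt0 eta D0)) d3.
apply: (is_derive_eq (is_deriveB (is_deriveZ 2 d2) d4)).
rewrite -![_ *: _]/(_ * _) /=.
have k1 : kern (-1) c (v `^ eta) = (Num.sqrt (1 - v ^+ 3))^-1.
  by rewrite kernE radicand_eta// mulN1r// ltW.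
have k2 : kern 1 c (duplication v `^ eta) =
    ((8 + 20 * v ^+ 3 - v ^+ 6) / (8 * (1 - v ^+ 3) * Num.sqrt (1 - v ^+ 3)))^-1.
  by rewrite kernE radicand_eta// mul1r ?duplication_cube// addr_ge0// exprn_ge0// ltW.
rewrite k1 k2; have s0 : 0 < Num.sqrt (1 - v ^+ 3) by rewrite sqrtr_gt0.
have E : Num.sqrt (1 - v ^+ 3) ^+ 2 = 1 - v ^+ 3 by rewrite sqr_sqrtr// ltW.
have n0 := duplication_num_gt0 v0 v1.
suff alg (A S q h P Q : R) : 0 < A -> 0 < S -> S ^+ 2 = q ->
    2 * (S^-1 * (h * P)) - (A / (8 * q * S))^-1 * (h * Q * (A / (4 * q ^+ 2))) =
    2 * h / S * (P - Q).
  exact: alg n0 s0 E.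
by move=> A0 S0 <-; field; rewrite !gt_eqF.
Qed.

Definition gap_slope : R := 2 * eta * (1 - 2 `^ (eta - 1)).

Let onem_gt0 : 0 < 1 - 2 `^ (eta - 1) :> R.
Proof.
rewrite subr_gt0 -[ltRHS](powRr0 2) /powR pnatr_eq0/= ltr_expR.
by rewrite ltr_pM2r ?ln_gt0 ?subr_lt0// ltr1n.
Qed.

Lemma gap_slope_gt0 : 0 < gap_slope.
Proof. by apply: mulr_gt0 => //; exact: mulr_gt0. Qed.

(** The derivative is at least [gap_slope], since [1 - t ^ 3 <= 1], [t^(eta - 1) >= 1] and
    [duplication t >= 2 * t]. *)
Lemma elliptic_gap_subr u v : 0 < u -> u <= v -> v < 1 ->
  gap_slope * (v - u) <= elliptic_gap v - elliptic_gap u.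
Proof.
move=> u0 uv v1; apply: (@is_derive_subr_ge R _ (fun v => 2 * eta /
  Num.sqrt (1 - v ^+ 3) * (v `^ (eta - 1) - duplication v `^ (eta - 1))))
    => [t ut tv|t ut tv|]; last exact: uv.
  by apply: is_derive_elliptic_gap; [exact: lt_le_trans ut|exact: le_lt_trans v1].
have t0 := lt_le_trans u0 ut; have t1 := le_lt_trans tv v1.
have q0 := onem_cube_gt0 t0 t1.
have D2 := duplication_ge t0 t1.
have D0 : 0 < duplication t by apply: lt_le_trans D2; rewrite mulr_gt0.
have e1 : eta - 1 <= 0 by rewrite subr_le0 ltW.
have A : 1 <= t `^ (eta - 1).
  rewrite -[leLHS](powRr0 t); apply: ger_powR => //.
  by rewrite t0 ltW.
have B : duplication t `^ (eta - 1) <= 2 `^ (eta - 1) * t `^ (eta - 1).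
  rewrite -(powRM _ (ler0n R 2) (ltW t0)); apply: le0_ler_powR => //.
  by rewrite mulr_gt0.
have C : 1 - 2 `^ (eta - 1) <= t `^ (eta - 1) - duplication t `^ (eta - 1).
  have : (1 - 2 `^ (eta - 1)) * 1 <= (1 - 2 `^ (eta - 1)) * t `^ (eta - 1).
    by rewrite ler_pM2l.
  by rewrite mulr1 mulrBl mul1r; lra.
have e0 : 0 <= 2 * eta by rewrite mulr_ge0// ltW.
rewrite /gap_slope; apply: ler_pM => //; first exact: ltW.
have s0 : 0 < Num.sqrt (1 - t ^+ 3) by rewrite sqrtr_gt0.
by rewrite ler_peMr// invf_ge1// -[leRHS]sqrtr1 ler_wsqrtr// gerBl exprn_ge0// ltW.
Qed.

Lemma normr_kern1_le t : `|kern 1 c t| <= 1.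
Proof.
rewrite ger0_norm ?kern_ge0// kernE ?(le_trans _ (ler_radicand1 _ _))//.
have s1 : 1 <= Num.sqrt (radicand 1 c t).
  by rewrite -[leLHS]sqrtr1 ler_wsqrtr// ler_radicand1.
by rewrite invf_le1// (lt_le_trans _ s1).
Qed.

Lemma Phi_le s : 0 <= s -> Phi s <= s.
Proof.
move=> s0; rewrite -[leRHS]mul1r; apply: primitive_le => //.
  exact: measurable_kern.
by move=> *; exact: normr_kern1_le.
Qed.

Lemma Gam_ge0 s : 0 <= Gam s.
Proof. by apply: primitive_ge0 => *; exact: kern_ge0. Qed.

Let gap_contradiction (d u v x y : R) : 0 < d * v - y -> d * (v - u) <= y - x ->
  - ((d * v - y) / 3) <= x -> d * u <= (d * v - y) / 3 -> False.
Proof. lra. Qed.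

(** The limit of [elliptic_gap_subr] as [u] tends to 0, carried out by contradiction with an
    explicit small [u]. *)
Lemma elliptic_gap_ge v : 0 < v -> v < 1 -> gap_slope * v <= elliptic_gap v.
Proof.
move=> v0 v1; rewrite leNgt; apply/negP => lt_gap.
pose g := gap_slope * v - elliptic_gap v.
have g0 : 0 < g by rewrite subr_gt0.
have d0 := gap_slope_gt0.
pose w := (g / 3) `^ eta^-1.
have w0 : 0 < w by rewrite powR_gt0// divr_gt0.
have wE : w `^ eta = g / 3.
  by rewrite -powRrM mulVf ?gt_eqF// powRr1// divr_ge0// ltW.
(* The bound [w / 3] gives [duplication u <= w], hence [Phi <= g / 3] at its power; the last bound
   gives [gap_slope * u <= g / 3]. Together these use only two thirds of the excess [g]. *)
pose u := Num.min (Num.min v 2^-1) (Num.min (w / 3) (g / (3 * gap_slope))).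
have g3 : 0 < g / (3 * gap_slope) by rewrite divr_gt0// mulr_gt0.
have u0 : 0 < u by rewrite /u !lt_min v0 g3 divr_gt0// invr_gt0 ltr0n.
have [uv u2 uw ug] : [/\ u <= v, u <= 2^-1, u <= w / 3 & u <= g / (3 * gap_slope)].
  by split; rewrite /u !ge_min lexx ?orbT.
have := elliptic_gap_subr u0 uv v1.
have ku : - (g / 3) <= elliptic_gap u.
  have D3 := duplication_le u0 u2.
  have D0 : 0 <= duplication u.
    by apply: le_trans (duplication_ge u0 (le_lt_trans uv v1)); rewrite mulr_ge0 ?ltW.
  have Dw : duplication u `^ eta <= g / 3.
    rewrite -wE; apply: ge0_ler_powR; rewrite ?nnegrE ?(ltW w0) ?(ltW eta_gt0)//.
    by move: D3 uw; lra.
  apply: (@le_trans _ _ (- Phi (duplication u `^ eta))).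
    by rewrite lerN2 (le_trans (Phi_le _))// powR_ge0.
  by rewrite lerDr mulr_ge0// Gam_ge0.
have du : gap_slope * u <= g / 3.
  have -> : g / 3 = gap_slope * (g / (3 * gap_slope)) by field; rewrite gt_eqF.
  by rewrite ler_pM2l.
by move=> gap_uv; exact: (gap_contradiction g0 gap_uv ku du).
Qed.

Lemma powR_le_sqrt_radicand s : s `^ c <= Num.sqrt (radicand 1 c s).
Proof.
rewrite -[leLHS](ger0_norm (powR_ge0 s c)) -sqrtr_sqr ler_wsqrtr//.
by rewrite /radicand mul1r lerDr.
Qed.

Lemma arc1_ge0 s : 0 < s -> 0 <= arc 1 c s.
Proof.
move=> s0; have p0 : 0 < s `^ c by apply: powR_gt0.
have q0 := powR_le_sqrt_radicand s.
by rewrite /arc subr_ge0 -ln_powR ler_ln ?posrE// ?(le_trans q0) ?lerDr//.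
Qed.

(** With [a] for the value of [arc], [a <= e^a - 1 <= e^a - e^(-a)], and [expR_arc] evaluates the
    last difference. *)
Lemma arc1_le s : 0 < s -> arc 1 c s <= 2 * s `^ (- c).
Proof.
move=> s0; rewrite powRN -(@expR_arc R 1 c s) ?(le_trans _ (ler_radicand1 _ _))//.
rewrite mul1r lerBrDr; apply: le_trans (expR_ge1Dx _).
by rewrite addrC lerD2r -[leRHS]expR0 ler_expR oppr_le0 arc1_ge0.
Qed.

Lemma is_derive_arc_prim1 s : 0 < s -> is_derive s 1 (arc_prim 1 c) (arc 1 c s).
Proof.
move=> s0; apply: (@is_derive_arc_prim_in R 1 c (s + 1) 1) => //.
- by move=> *; exact: ler_radicand1.
- by rewrite ltrDl.
Qed.

Lemma arc_prim1_le x y : 0 < x -> x <= y -> arc_prim 1 c x <= arc_prim 1 c y.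
Proof.
move=> x0 xy; apply: (@is_derive_le R _ (arc 1 c)) => // t xt ty.
  by apply: is_derive_arc_prim1; exact: lt_le_trans xt.
by apply: arc1_ge0; exact: lt_le_trans xt.
Qed.

Lemma arc_prim1_le_Phi s : 0 < s -> arc_prim 1 c s <= 2 * s `^ (1 - c) + c * Phi s.
Proof.
move=> s0; rewrite /arc_prim lerD2r.
have -> : s `^ (1 - c) = s * s `^ (- c).
  by rewrite powRD ?(gt_eqF s0) ?implybT// powRr1// ltW.
by rewrite [leRHS]mulrCA ler_pM2l// arc1_le.
Qed.

(** Since [kern 1 c t <= t^(-c)], adding the tail integral of [t^(-c)] to [Phi] gives a
    nonincreasing function. *)
Lemma Phi_subr_le x y : 0 < x -> x <= y -> Phi y - Phi x <= x `^ (1 - c) / (c - 1).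
Proof.
move=> x0 xy; have c1 : 0 < c - 1 by have := hc; lra.
suff : Phi y + y `^ (1 - c) / (c - 1) <= Phi x + x `^ (1 - c) / (c - 1).
  rewrite lerBlDl; apply: le_trans.
  by rewrite lerDl divr_ge0 ?powR_ge0// ltW.
rewrite -lerN2.
apply: (@is_derive_le R (fun t => - (Phi t + t `^ (1 - c) / (c - 1)))
  (fun t => - (kern 1 c t - t `^ (- c)))) => // t xt ty; have t0 := lt_le_trans x0 xt.
  have d1 := is_derive_Phi t0.
  have d2 := is_derive1_powR (1 - c) t0.
  have d3 := is_deriveM d2 (is_derive_cst (c - 1)^-1 t (1 : R)).
  apply: (is_derive_eq (is_deriveN (is_deriveD d1 d3))).
  rewrite -![_ *: _]/(_ * _) /=.
  rewrite mulr0 add0r -(addrAC 1 (- 1)) subrr add0r.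
  field; by rewrite gt_eqF.
rewrite oppr_ge0 subr_le0 kernE ?(le_trans _ (ler_radicand1 _ _))//.
have p0 : 0 < t `^ c by apply: powR_gt0.
have q0 := powR_le_sqrt_radicand t.
by rewrite powRN lef_pV2 ?posrE// (lt_le_trans p0).
Qed.

Let bound_lt (g G P X : R) : 0 < g -> g * (2 / 3) <= 2 * G - P ->
  X < c * g / 2 -> c * P + X < 2 * (c * G).
Proof.
move=> g0; rewrite -(ler_pM2l c0) mulrBr => H; have : 0 < c * g by exact: mulr_gt0.
lra.
Qed.

(* The constant 3/2 is sharp here: for [c = 3/2] the least such [A] is the limit
   of the right-hand side as [s1] tends to 1. *)
Lemma arc_prim1_lt_Gam : exists s1, [/\ 0 < s1, s1 < 1 &
  exists2 A, A < 2 * (c * Gam s1) & forall s, 0 < s -> arc_prim 1 c s <= A].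
Proof.
have c1 : 0 < c - 1 by have := hc; lra.
have d0 := gap_slope_gt0.
have th0 : 0 < eta * (c - 1) by rewrite mulr_gt0.
have q0 : 0 < 2 + c / (c - 1) by rewrite addr_gt0// divr_gt0.
(* The tail error is to cost at most half of [c * gap_slope], less than the two thirds that the gap
   provides once [v >= 2 / 3]. *)
have [eps eps0 epsE] : exists2 eps, 0 < eps &
    (2 + c / (c - 1)) * eps = c * gap_slope / 2.
  exists (c * gap_slope / 2 / (2 + c / (c - 1))).
    by apply: divr_gt0 => //; apply: divr_gt0 => //; exact: mulr_gt0.
  by rewrite mulrC divfK// gt_eqF.
(* Chosen so that [N^(eta * (1 - c))] is [1 / (1 + 1 / eps)], which is below [eps]; the summand 1
   ensures [N >= 1]. *)
pose N := (1 + eps^-1) `^ (eta * (c - 1))^-1.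
have e1 : 1 <= 1 + eps^-1 by rewrite lerDl invr_ge0 ltW.
have N1 : 1 <= N.
  by rewrite -[leLHS](powRr0 (1 + eps^-1)) ler_powR// invr_ge0 ltW.
have N0 : 0 < N by exact: lt_le_trans N1.
have NE : N `^ (eta * (1 - c)) = (1 + eps^-1)^-1.
  rewrite -(opprB c 1) mulrN powRN -powRrM mulVf ?gt_eqF// powRr1// (le_trans _ e1)//.
have iN : N^-1 <= 1 by rewrite invf_le1.
have iN0 : 0 < N^-1 by rewrite invr_gt0.
(* With this choice [duplication_ge_inv] reads [N <= duplication v], and [N >= 1] gives
   [v >= 2 / 3]. *)
pose v := 1 - (3 * N)^-1.
have vE : 3 * (1 - v) = N^-1 by rewrite /v; field; rewrite gt_eqF.
have v1 : v < 1 by lra.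
have v2 : 2 / 3 <= v by lra.
have v0 : 0 < v by lra.
have DN : N <= duplication v.
  by have := @duplication_ge_inv R v; rewrite vE invrK; apply; lra.
have D0 := lt_le_trans N0 DN.
pose T := duplication v `^ eta.
have T0 : 0 < T by exact: powR_gt0.
have Teps : T `^ (1 - c) < eps.
  apply: (@le_lt_trans _ _ (N `^ (eta * (1 - c)))).
    by rewrite -powRrM le0_ler_powR// -(opprB c 1) mulrN oppr_le0 ltW.
  have i0 : 0 < eps^-1 by rewrite invr_gt0.
  have n0 : 0 < 1 + eps^-1 by exact: lt_le_trans e1.
  by rewrite NE -[ltRHS]invrK ltf_pV2 ?posrE// ltrDr.
exists (v `^ eta); split; [exact: powR_gt0|exact: powR_eta_lt1|].
exists (c * Phi T + (2 + c / (c - 1)) * T `^ (1 - c)).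
  have : gap_slope * (2 / 3) <= 2 * Gam (v `^ eta) - Phi T.
    by apply: le_trans (elliptic_gap_ge v0 v1); rewrite ler_pM2l.
  move=> H; apply: (bound_lt d0 H).
  by rewrite -epsE ltr_pM2l.
move=> s s0.
have -> : c * Phi T + (2 + c / (c - 1)) * T `^ (1 - c) =
    2 * T `^ (1 - c) + c * (Phi T + T `^ (1 - c) / (c - 1)).
  by field; rewrite gt_eqF.
(* Up to [T] monotonicity suffices; beyond it [s^(1 - c)] decreases and [Phi_subr_le] bounds the
   tail of [Phi]. *)
have [sT|/ltW Ts] := leP s T.
  apply: le_trans (arc_prim1_le s0 sT) (le_trans (arc_prim1_le_Phi T0) _).
  by rewrite lerD2l ler_pM2l// lerDl divr_ge0 ?powR_ge0// ltW.
apply: le_trans (arc_prim1_le_Phi s0) _; apply: lerD.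
  by rewrite ler_pM2l// le0_ler_powR// -(opprB c 1) oppr_le0 ltW.
by rewrite ler_pM2l// -lerBlDl Phi_subr_le.
Qed.

End SharpConstant.

(** * Sums of negative powers and nonnegative series *)

Section PowerSums.
Context {R : realType}.
Implicit Types (c p x y : R) (n : nat).

Lemma le_sum_powRN c : 1 < c -> forall n,
  \sum_(i < n) i.+1%:R `^ (- c) <= 1 + (c - 1)^-1 :> R.
Proof.
move=> c1; have d0 : 0 < c - 1 by rewrite subr_gt0.
pose f t := - (t `^ (1 - c) / (c - 1)).
have step n : n.+2%:R `^ (- c) <= f n.+2%:R - f n.+1%:R.
  have := @is_derive_subr_ge R f (fun t => t `^ (- c)) (n.+2%:R `^ (- c)) n.+1%:R n.+2%:R.
  rewrite -natrB// subSnn mulr1; apply; last by rewrite ler_nat.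
    move=> t nt _; have t0 : 0 < t by apply: lt_le_trans nt; rewrite ltr0n.
    have d1 := is_deriveM (is_derive1_powR (1 - c) t0) (is_derive_cst (c - 1)^-1 t (1 : R)).
    apply: (is_derive_eq (is_deriveN d1)).
    rewrite -![_ *: _]/(_ * _) /= mulr0 add0r -(addrAC 1 (- 1)) subrr add0r.
    by field; rewrite gt_eqF.
  move=> t nt tn; apply: le0_ler_powR => //; first by rewrite oppr_le0; lra.
  by apply: lt_le_trans nt; rewrite ltr0n.
case=> [|n]; first by rewrite big_ord0 addr_ge0// invr_ge0 ltW.
have : \sum_(i < n.+1) i.+1%:R `^ (- c) <= 1 + (f n.+1%:R - f 1).
  elim: n => [|n IH]; first by rewrite big_ord1 subrr addr0 powR1.
  rewrite big_ord_recr/=; have := step n; move: IH.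
  by move: (\sum_(i < _) _) (f _) (f _) (f _) (_ `^ _) => A B C D X; lra.
move=> H; apply: le_trans H _; rewrite lerD2l /f opprK powR1 mul1r gerDr oppr_le0.
by rewrite divr_ge0 ?powR_ge0// ltW.
Qed.

Lemma nneseries_le (u : nat -> \bar R) (M : \bar R) k :
  (forall n, 0 <= u n)%E -> (forall n, \sum_(k <= i < n) u i <= M)%E ->
  (\sum_(k <= i <oo) u i <= M)%E.
Proof.
move=> u0 uM; apply: lime_le; first exact: is_cvg_nneseries.
by near=> n; exact: uM.
Unshelve. all: by end_near. Qed.

End PowerSums.

(** * Upper bounds for the coefficients of [P_n] and for [coef_norm] *)

Section CoefficientBounds.
Context {R : realType}.
Implicit Types (b r : nat -> R) (c y kap : R) (n k l : nat).

Lemma orthopolySS b n :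
  orthopoly b n.+2 = (b n.+1)^-1 *: ('X * orthopoly b n.+1 - b n *: orthopoly b n).
Proof.
by rewrite /orthopoly /=; case: (orthopoly_pair b n) => p q.
Qed.

Lemma orthopoly1 b : orthopoly b 1 = (b 0%N)^-1 *: 'X.
Proof. by rewrite /orthopoly /= scaler0 subr0 mulr1. Qed.

(** In absolute values the minus sign of the recurrence becomes a plus, so any supersolution [r] of
    the positive recurrence dominates, by induction on consecutive pairs. *)
Lemma coef_orthopoly_le b r y : (forall n, 0 < b n) -> 0 <= y ->
  1 <= r 0%N -> y / b 0%N <= r 1%N ->
  (forall n, y * r n.+1 + b n * r n <= b n.+1 * r n.+2) ->
  forall n k, `|(orthopoly b n)`_k| * y ^+ k <= r n.
Proof.
move=> b0 y0 r0 r1 rS n.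
suff : (forall k, `|(orthopoly b n)`_k| * y ^+ k <= r n) /\
       (forall k, `|(orthopoly b n.+1)`_k| * y ^+ k <= r n.+1) by case.
elim: n => [|n [IH0 IH1]].
  have r0' : 0 <= r 0%N by apply: le_trans r0.
  have r1' : 0 <= r 1%N by apply: le_trans r1; rewrite divr_ge0// ltW.
  split=> k.
    by rewrite orthopoly0 coefC; case: k => [|k]; rewrite /= ?normr1 ?normr0 ?mul0r ?mul1r.
  rewrite orthopoly1 coefZ coefX; case: k => [|[|k]]; rewrite /= ?mulr0 ?normr0 ?mul0r//.
  by rewrite mulr1 expr1 ger0_norm ?invr_ge0 ?(ltW (b0 _))// mulrC.
split=> // k; rewrite orthopolySS coefZ normrM gtr0_norm ?invr_gt0//.
rewrite -mulrA mulrC ler_pdivrMr// [leRHS]mulrC.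
apply: le_trans (rS n); rewrite coefB coefXM coefZ.
have H0 : 0 <= r n.+1 by apply: le_trans (IH1 0%N); rewrite mulr_ge0.
case: k => [|k] /=.
  rewrite sub0r normrN normrM (gtr0_norm (b0 _)) expr0 mulr1.
  rewrite ler_wpDl ?mulr_ge0// ler_pM2l//.
  by have := IH0 0%N; rewrite expr0 mulr1.
apply: (@le_trans _ _ (y * (`|(orthopoly b n.+1)`_k| * y ^+ k) +
    b n * (`|(orthopoly b n)`_k.+1| * y ^+ k.+1))); last first.
  by apply: lerD; [exact: ler_wpM2l|rewrite ler_pM2l].
have -> : y * (`|(orthopoly b n.+1)`_k| * y ^+ k) +
    b n * (`|(orthopoly b n)`_k.+1| * y ^+ k.+1) =
  (`|(orthopoly b n.+1)`_k| + b n * `|(orthopoly b n)`_k.+1|) * y ^+ k.+1.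
  by rewrite exprS; ring.
rewrite ler_wpM2r ?exprn_ge0//; apply: le_trans (ler_normB _ _) _.
by rewrite normrM (gtr0_norm (b0 _)).
Qed.

Lemma power_coef_gt0 c n : 0 < c -> 0 < power_coef c n.
Proof. by move=> c0; rewrite mulr_gt0 ?powR_gt0// ltr0n. Qed.

Section Majorant.
Context (c kap : R) (c0 : 0 < c) (kap1 : 1 <= kap).

Let kap0 : 0 < kap. Proof. exact: lt_le_trans kap1. Qed.

(** A WKB-type supersolution with amplitude of order [b_n^(-1/2)]. The argument of [arc] lags one
    index behind the coefficient, which makes room for the inequality; [maxn i 1] avoids the
    argument 0, and [2^(c/2)] normalizes the case [n = 1]. *)
Definition majorant n : R := 2 `^ (c / 2) * (n.+1%:R `^ (c / 2))^-1 *
  expR (\sum_(i < n) arc 1 c ((maxn i 1)%:R / kap)).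

Let halfpow (n : nat) : R := n%:R `^ (c / 2).

Let halfpow_gt0 n : 0 < halfpow n.+1. Proof. by rewrite powR_gt0. Qed.

Let halfpow_le m n : (m <= n)%N -> halfpow m <= halfpow n.
Proof.
by move=> mn; rewrite ge0_ler_powR ?nnegrE ?ler_nat// divr_ge0// ltW.
Qed.

Let halfpow_sqr n : halfpow n ^+ 2 = n%:R `^ c.
Proof.
rewrite -powR_mulrn ?powR_ge0// -powRrM; congr (_ `^ _).
by field.
Qed.

Let halfpow_logconcave n : halfpow n.+1 * halfpow n.+3 <= halfpow n.+2 ^+ 2.
Proof.
rewrite expr2 /halfpow -!powRM// -!natrM ge0_ler_powR ?nnegrE// ?ler_nat; last lia.
by rewrite divr_ge0// ltW.
Qed.

(** The supersolution inequality with [p_i = (n + i)^(c/2)], [e] and [f] the exponentials of [arc]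
    and its opposite, and [U], [V] the exponentials of consecutive sums. Both sides are compared
    with [p1 * U * e]. *)
Let majorant_alg (p1 p2 p3 e f U V : R) : 0 < p1 -> p1 <= p2 -> 0 < p3 ->
  p1 * p3 <= p2 ^+ 2 -> 1 <= e -> 0 < f -> f <= 1 ->
  0 < U -> V <= f * U ->
  p1 ^+ 2 * (e - f) / p2 * U + p1 * V <= p2 ^+ 2 / p3 * (U * e).
Proof.
move=> p10 p12 p30 p13 e1 f0 f1 U0 VU.
have p20 : 0 < p2 by exact: lt_le_trans p12.
have A : p1 <= p2 ^+ 2 / p3 by rewrite ler_pdivlMr.
apply: (@le_trans _ _ (p1 * (U * e))); last first.
  by apply: ler_wpM2r => //; rewrite mulr_ge0// ltW// (lt_le_trans _ e1).
have D : p1 ^+ 2 / p2 <= p1 by rewrite ler_pdivrMr// expr2 ler_pM2l.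
apply: (@le_trans _ _ (p1 * (e - f) * U + p1 * (f * U))).
  apply: lerD; last by rewrite ler_pM2l.
  rewrite ler_pM2r// mulrAC ler_wpM2r// subr_ge0; exact: le_trans e1.
by rewrite le_eqVlt; apply/orP; left; apply/eqP; ring.
Qed.

Lemma coef_orthopoly_majorant n k :
  `|(orthopoly (power_coef c) n)`_k| * (2 * (c * kap) `^ c) ^+ k <= majorant n.
Proof.
apply: coef_orthopoly_le => {n k} [n| | | |n].
- exact: power_coef_gt0.
- by rewrite mulr_ge0// powR_ge0.
- rewrite /majorant big_ord0 expR0 powR1 invr1 !mulr1.
  by rewrite -[leLHS](powRr0 2); apply: ler_powR; rewrite ?ler1n ?divr_ge0// ltW.
- rewrite /majorant big_ord1 /= mulfV ?gt_eqF ?powR_gt0// mul1r.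
  rewrite /power_coef powR1 mulr1 powRM ?ltW// mulrCA mulrAC mulfV ?mul1r ?gt_eqF ?powR_gt0//.
  have <- : ((1 / kap) `^ c)^-1 = kap `^ c.
    by rewrite div1r -(powR_inv1 (ltW kap0)) -powRrM mulN1r powRN invrK.
  rewrite -(@expR_arc R 1 c (1 / kap)) ?divr_gt0// ?(le_trans _ (ler_radicand1 _ _))//.
  by rewrite div1r mul1r gtrBl expR_gt0.
rewrite /majorant [in leRHS]big_ord_recr /= (maxn_idPl (ltn0Sn n)) expRD.
set a := arc 1 c (n.+1%:R / kap); set S := \sum_(i < n.+1) _.
have a0 : 0 <= a by apply: arc1_ge0 => //; rewrite divr_gt0// ltr0n.
have VU : expR (\sum_(i < n) arc 1 c ((maxn i 1)%:R / kap)) <= expR (- a) * expR S.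
  rewrite -expRD ler_expR /S big_ord_recr /=.
  rewrite addrCA lerDl [leRHS]addrC subr_ge0.
  apply: (@arc_nincr R 1 c (n.+1%:R / kap) 1) => //; first exact: ltW.
  - by move=> *; exact: ler_radicand1.
  - by rewrite divr_gt0// ltr0n; lia.
  - by rewrite ler_pM2r ?invr_gt0// ler_nat; lia.
have aE : 2 * kap `^ c = n.+1%:R `^ c * (expR a - expR (- a)).
  have := @expR_arc R 1 c (n.+1%:R / kap); rewrite divr_gt0// (le_trans _ (ler_radicand1 _ _))//.
  move=> /(_ isT isT); rewrite mul1r => ->.
  rewrite powRM ?invr_ge0 ?ltW// -(powR_inv1 (ltW kap0)) powRAC powR_inv1 ?powR_ge0//.
  by rewrite invfM invrK; field; rewrite gt_eqF ?powR_gt0.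
have cc : 0 < c `^ c by rewrite powR_gt0.
have k2 : 0 < 2 `^ (c / 2) :> R by rewrite powR_gt0.
have f1 : expR (- a) <= 1 by rewrite -[leRHS]expR0 ler_expR oppr_le0.
have e1 : 1 <= expR a by rewrite -[leLHS]expR0 ler_expR.
have := majorant_alg (halfpow_gt0 n) (halfpow_le (leqnSn _)) (halfpow_gt0 n.+2)
   (halfpow_logconcave n) e1 (expR_gt0 _) f1 (expR_gt0 S) VU.
rewrite halfpow_sqr -aE -(ler_pM2l (mulr_gt0 cc k2)).
rewrite /power_coef (powRM _ (ltW c0) (ltW kap0)) -!halfpow_sqr.
have p1 := halfpow_gt0 n; have p2 := halfpow_gt0 n.+1; have p3 := halfpow_gt0 n.+2.
rewrite -/(halfpow n.+1) -/(halfpow n.+2) -/(halfpow n.+3).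
have conv (x y x' y' : R) : x <= y -> x = x' -> y = y' -> x' <= y' by move=> + <- <-.
by move=> H; apply: conv H _ _; field; rewrite !gt_eqF.
Qed.

Lemma arc_prim1_ge0 s : 0 < s -> 0 <= arc_prim 1 c s.
Proof.
move=> s0; rewrite addr_ge0// mulr_ge0//; [exact: ltW|exact: arc1_ge0|exact: ltW|].
by apply: primitive_ge0 => *; exact: kern_ge0.
Qed.

(** The factor 2 counts the repeated term at [i = 0] and the first term kept apart by
    [sum_arc_le]. *)
Lemma sum_arc1_le A n : (forall s, 0 < s -> arc_prim 1 c s <= A) ->
  \sum_(i < n) arc 1 c ((maxn i 1)%:R / kap) <= 2 * arc 1 c kap^-1 + kap * A.
Proof.
move=> FA; have k1 : 0 < 1 / kap by rewrite divr_gt0.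
have a0 : 0 <= arc 1 c kap^-1 by apply: arc1_ge0 => //; rewrite invr_gt0.
have A0 : 0 <= kap * A.
  by rewrite mulr_ge0 ?(ltW kap0)// (le_trans (arc_prim1_ge0 k1))// FA.
rewrite mulr_natl mulr2n -addrA.
case: n => [|[|n]].
- by rewrite big_ord0; apply: addr_ge0 => //; exact: addr_ge0.
- by rewrite big_ord1 /= div1r lerDl; exact: addr_ge0.
rewrite big_ord_recl /= [in leLHS]div1r lerD2l.
under eq_bigr do rewrite (maxn_idPl (ltn0Sn _)).
apply: le_trans (@sum_arc_le R 1 c (n.+2%:R / kap) 1 (ltW c0) ltr01 _ kap n kap0 _) _.
- by move=> *; exact: ler_radicand1.
- by rewrite ltr_pM2r ?invr_gt0// ltr_nat.
rewrite div1r lerD2l ler_pM2l// lerBlDr.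
apply: le_trans (FA _ _) _; first by rewrite divr_gt0// ltr0n.
by rewrite lerDl arc_prim1_ge0// invr_gt0.
Qed.

(** The squared amplitude of the majorant is of order [(n + 1)^(-c)], summable as [c > 1]. The
    parameter [kap >= 1] remains free. *)
Lemma coef_norm_le A l : 1 < c -> (forall s, 0 < s -> arc_prim 1 c s <= A) ->
  (coef_norm (power_coef c) l <=
   (Num.sqrt (2 `^ c * (1 + (c - 1)^-1)) * expR (2 * arc 1 c kap^-1 + kap * A)
     / (2 * (c * kap) `^ c) ^+ l)%:E)%E.
Proof.
move=> c1 FA; set y := 2 * (c * kap) `^ c; set E := expR _.
have y0 : 0 < y by rewrite mulr_gt0// powR_gt0// mulr_gt0.
have E0 : 0 < E by exact: expR_gt0.
have Z0 : 0 <= 1 + (c - 1)^-1 by rewrite addr_ge0// invr_ge0 subr_ge0 ltW.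
have yl : 0 < y ^+ l by rewrite exprn_gt0.
have B n : (orthopoly (power_coef c) n)`_l ^+ 2 <=
    2 `^ c * (E / y ^+ l) ^+ 2 * n.+1%:R `^ (- c).
  rewrite -real_normK ?num_real//.
  have -> : `|(orthopoly (power_coef c) n)`_l| =
      `|(orthopoly (power_coef c) n)`_l| * y ^+ l / y ^+ l by rewrite mulfK ?gt_eqF.
  have -> : 2 `^ c * (E / y ^+ l) ^+ 2 * n.+1%:R `^ (- c) =
      (halfpow 2 * (halfpow n.+1)^-1 * E / y ^+ l) ^+ 2.
    rewrite powRN -!halfpow_sqr; field; rewrite !gt_eqF ?halfpow_gt0//.
  rewrite lerXn2r ?nnegrE ?divr_ge0 ?mulr_ge0 ?invr_ge0 ?(ltW E0) ?(ltW yl) ?powR_ge0//.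
  rewrite ler_pM2r ?invr_gt0//; apply: le_trans (coef_orthopoly_majorant n l) _.
  rewrite /majorant ler_wpM2l ?mulr_ge0 ?invr_ge0 ?powR_ge0// ler_expR.
  exact: sum_arc1_le.
have -> : (Num.sqrt (2 `^ c * (1 + (c - 1)^-1)) * E / y ^+ l)%:E =
    sqrte (2 `^ c * (E / y ^+ l) ^+ 2 * (1 + (c - 1)^-1))%:E.
  rewrite /sqrte; congr EFin.
  rewrite [in RHS]mulrAC [in RHS]sqrtrM ?mulr_ge0 ?powR_ge0// sqrtr_sqr ger0_norm ?divr_ge0 ?(ltW E0) ?(ltW yl)//.
  by rewrite mulrA.
rewrite /coef_norm lee_sqrt; last first.
  by rewrite lee_fin !mulr_ge0 ?powR_ge0 ?invr_ge0 ?(ltW E0) ?(ltW yl)// addr_ge0// ltW.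
apply: nneseries_le => [n|n]; first by rewrite lee_fin sqr_ge0.
rewrite sumEFin lee_fin.
apply: (@le_trans _ _ (\sum_(l <= i < n) 2 `^ c * (E / y ^+ l) ^+ 2 * i.+1%:R `^ (- c))).
  by apply: ler_sum => i _; exact: B.
have K0 : 0 <= 2 `^ c * (E / y ^+ l) ^+ 2.
  by apply: mulr_ge0; [exact: powR_ge0|exact: sqr_ge0].
rewrite -mulr_sumr ler_wpM2l//.
apply: le_trans (le_sum_powRN c1 n); rewrite -(big_mkord xpredT (fun i => i.+1%:R `^ (- c))).
have [ln|ln] := leqP l n; last first.
  by rewrite [leLHS]big_geq ?(ltnW ln)//; apply: sumr_ge0 => i _; exact: powR_ge0.
by rewrite [leRHS](@big_cat_nat _ _ _ l)//= lerDr; apply: sumr_ge0 => i _; exact: powR_ge0.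
Qed.

End Majorant.
End CoefficientBounds.

(** * Parity of [P_n] and a product lower bound for its values *)

Section LowerBound.
Context {R : realType}.
Implicit Types (b th : nat -> R) (x : R) (n K : nat).

Lemma orthopoly_horner_opp b n x :
  (orthopoly b n).[- x] = (-1) ^+ n * (orthopoly b n).[x].
Proof.
suff : (orthopoly b n).[- x] = (-1) ^+ n * (orthopoly b n).[x] /\
  (orthopoly b n.+1).[- x] = (-1) ^+ n.+1 * (orthopoly b n.+1).[x] by case.
elim: n => [|n [IH0 IH1]].
  by rewrite orthopoly0 orthopoly1 !hornerZ !hornerX !hornerC; split; ring.
split=> //; rewrite orthopolySS !hornerZ !hornerD !hornerN !hornerZ !hornerM !hornerX IH0 IH1 !exprS.
ring.
Qed.

(** The induction carries [P_(n+1) >= th_n * P_n > 0]. Splitting [x / b_(n+1)] into [th_(n+1)] and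
    its inverse, the inverse part absorbs the subtracted [P_n] term because [th] decreases and [b]
    increases. *)
Lemma prod_le_orthopoly b th x K : (forall n, 0 < b n) ->
  (forall n, b n <= b n.+1) -> (forall n, 0 < th n) ->
  (forall n, (n < K)%N -> th n + (th n)^-1 = x / b n) ->
  (forall n, (n.+1 < K)%N -> th n.+1 <= th n) ->
  forall n, (n <= K)%N -> \prod_(i < n) th i <= (orthopoly b n).[x].
Proof.
move=> b0 bS th0 thE thS.
have step n : (n < K)%N -> 0 < (orthopoly b n).[x] /\
    th n * (orthopoly b n).[x] <= (orthopoly b n.+1).[x].
  elim: n => [|n IH] nK.
    rewrite orthopoly0 orthopoly1 hornerZ hornerX hornerC mulr1; split => //.
    by rewrite mulrC -thE// lerDl invr_ge0 ltW.
  have [p0 p1] := IH (ltnW nK); have p1' := lt_le_trans (mulr_gt0 (th0 n) p0) p1.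
  split=> //; rewrite orthopolySS hornerZ hornerD hornerN hornerZ hornerM hornerX.
  set p := (orthopoly b n).[x] in p0 p1 *; set q := (orthopoly b n.+1).[x] in p1 p1' *.
  have -> : (b n.+1)^-1 * (x * q - b n * p) = x / b n.+1 * q - b n / b n.+1 * p.
    by field; rewrite gt_eqF.
  rewrite -thE// mulrDl -addrA lerDl subr_ge0.
  apply: (@le_trans _ _ p).
    by rewrite ler_piMl ?(ltW p0)// ler_pdivrMr ?mul1r.
  rewrite mulrC ler_pdivlMr//; apply: le_trans p1; rewrite mulrC.
  by rewrite ler_pM2r// thS.
elim=> [|n IH] nK; first by rewrite big_ord0 orthopoly0 hornerE.
have [p0 p1] := step n nK; rewrite big_ord_recr /=; apply: le_trans p1.
by rewrite mulrC ler_pM2l// IH// ltnW.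
Qed.

End LowerBound.

(** Bookkeeping for [k = kap], [i = 1 / kap], [s = s1] and the last grid point [t]: moving from [t]
    to [s] and dropping the primitive at [i] cost [c * M] each, and [k * i = 1] leaves a single
    [arc] value at [i]. *)
Fact lower_exponent_le (R : realFieldType) (c k i M s t gs gt gi a_t a_i l2 lk : R) :
  0 < c -> 0 < k -> 0 < t -> 0 <= M -> k * i = 1 ->
  gs - gt <= M * (s - t) -> gi <= M * i -> a_i <= l2 + lk -> 0 <= a_t ->
  k * (s - t) <= 1 ->
  k * (c * gs) - (2 * c * M + l2) - lk <=
  k * (t * a_t + c * gt - (i * a_i + c * gi)).
Proof.
move=> c0 k0 t0 M0 ki H1 H2 H3 H4 H5.
have G1 : k * (gs - gt) <= M.
  apply: (@le_trans _ _ (M * (k * (s - t)))); first by rewrite mulrCA ler_pM2l.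
  by rewrite -[leRHS]mulr1 ler_wpM2l.
have G2 : k * gi <= M by rewrite -[leRHS]mulr1 -ki mulrCA ler_pM2l.
have G3 : 0 <= k * (t * a_t) by rewrite !mulr_ge0// ltW.
have -> : k * (t * a_t + c * gt - (i * a_i + c * gi)) =
  k * (t * a_t) + k * (c * gs) - c * (k * (gs - gt)) - (k * i) * a_i - c * (k * gi) by ring.
have := ler_wpM2l (ltW c0) G1; have := ler_wpM2l (ltW c0) G2; rewrite ki.
lra.
Qed.

(** * Exponential lower bound for [P_K] with power coefficients *)

Section PowerLowerBound.
Context {R : realType} (c s1 : R) (hc : 3 / 2 < c) (s10 : 0 < s1) (s11 : s1 < 1).
Implicit Types (kap x s : R) (n K : nat).

Let c0 : 0 < c. Proof. by apply: lt_trans hc; lra. Qed.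

(** The midpoint of [s1] and 1 leaves room to the right of [s1] while the kernel stays bounded. *)
Let b := (1 + s1) / 2.

Let sb : s1 < b. Proof. by rewrite /b; have := s11; lra. Qed.

Let b1 : b < 1. Proof. by rewrite /b; have := s11; lra. Qed.

Let m := 1 - (b `^ c) ^+ 2.

Let c0' : 0 <= c. Proof. exact: ltW. Qed.

Let m0 : 0 < m.
Proof.
by rewrite subr_gt0 exprn_ilt1// ?powR_ge0// powR_lt1// ltW// (lt_trans s10).
Qed.

Let hm t : 0 <= t -> t <= b -> m <= radicand (-1) c t.
Proof. by move=> t0 ts; apply: ler_radicandN1 => //; exact: ltW. Qed.

Let M := (Num.sqrt m)^-1.

Local Notation Gam := (primitive (kern (-1) c)).

Let Gam_le s : 0 <= s -> s <= b -> Gam s <= M * s.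
Proof.
move=> s0 sb'; apply: primitive_le => //; first exact: measurable_kern.
by move=> t t0 ts; apply: (normr_kern_le m0 hm) => //; exact: le_trans sb'.
Qed.

Let Gam_subr_le s t : 0 < s -> s <= t -> t < b -> Gam t - Gam s <= M * (t - s).
Proof.
move=> s0 st tb; apply: (@is_derive_subr_le R Gam (kern (-1) c)) => // u su ut.
  apply: (is_derive_primitive_kern m0 hm); first exact: lt_le_trans su.
  exact: le_lt_trans tb.
apply: (kern_le m0 hm); first by apply: ltW; exact: lt_le_trans su.
exact: le_trans ut (ltW tb).
Qed.

Lemma arcN1_inv_le kap : 0 < kap -> arc (-1) c kap^-1 <= ln 2 + c * ln kap.
Proof.
move=> k0; rewrite /arc lnV ?posrE// mulrN opprK lerD2r.
have q : Num.sqrt (radicand (-1) c kap^-1) <= 1.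
  by rewrite -[leRHS]sqrtr1 ler_wsqrtr// /radicand mulN1r gerBl sqr_ge0.
by rewrite ler_ln ?posrE ?ltr_pwDl ?sqrtr_ge0//; lra.
Qed.

Lemma arc1_inv_le kap : 1 <= kap -> arc 1 c kap^-1 <= ln 3 + c * ln kap.
Proof.
move=> k1; have k0 : 0 < kap by exact: lt_le_trans k1.
rewrite /arc lnV ?posrE// mulrN opprK lerD2r.
have q : Num.sqrt (radicand 1 c kap^-1) <= 2.
  rewrite -[leRHS]ger0_norm// -sqrtr_sqr ler_wsqrtr// /radicand mul1r.
  have : kap^-1 `^ c <= 1.
    rewrite -[leRHS](powRr0 kap^-1); apply: ger_powR; last exact: ltW.
    by rewrite invr_gt0 k0 invf_le1.
  have := powR_ge0 kap^-1 c; move: (_ `^ _) => u; nra.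
by rewrite ler_ln ?posrE ?ltr_pwDl ?sqrtr_ge0//; lra.
Qed.

Lemma orthopoly_lower : exists C, forall kap, s1^-1 <= kap ->
  exists2 K, K.+1%:R <= kap & forall x, `|x| = 2 * (c * kap) `^ c ->
    expR (2 * (kap * (c * primitive (kern (-1) c) s1) - C - c * ln kap)) <=
    (orthopoly (power_coef c) K).[x] ^+ 2.
Proof.
exists (2 * c * M + ln 2) => kap ks.
have k0 : 0 < kap by apply: lt_le_trans ks; rewrite invr_gt0.
have sk1 : 1 <= s1 * kap by rewrite mulrC -ler_pdivrMr// mul1r.
(* [K + 1] is the integer part of [s1 * kap]: the grid stays at or below [s1] and ends within
   [1 / kap] of it. *)
have [K KE] : exists K, Num.truncn (s1 * kap) = K.+1.
  by exists (Num.truncn (s1 * kap)).-1; rewrite prednK// truncn_gt0.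
have /andP[] := truncn_itv (le_trans ler01 sk1); rewrite KE => Ks sK.
have Kk : K.+1%:R / kap <= s1 by rewrite ler_pdivrMr.
have ik : kap^-1 <= s1 by rewrite -[s1]invrK lef_pV2 ?posrE ?invr_gt0.
have Kk0 : 0 < K.+1%:R / kap by rewrite divr_gt0// ltr0n.
exists K.
  by apply: le_trans Ks _; rewrite ler_piMl ?ltW.
have arc_le n : (n < K)%N -> n.+1%:R / kap < 1.
  move=> nK; apply: le_lt_trans s11; apply: le_trans Kk.
  by rewrite ler_pM2r ?invr_gt0// ler_nat ltnS ltnW.
have lower y : y = 2 * (c * kap) `^ c ->
    expR (kap * (c * Gam s1) - (2 * c * M + ln 2) - c * ln kap) <=
    (orthopoly (power_coef c) K).[y].
  move=> yE; apply: (@le_trans _ _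
    (\prod_(i < K) expR (arc (-1) c (i.+1%:R / kap)))); last first.
    apply: (@prod_le_orthopoly R _ (fun i => expR (arc (-1) c (i.+1%:R / kap))) y K) => //.
    - by move=> n; exact: power_coef_gt0.
    - move=> n; rewrite ler_pM2l ?powR_gt0//.
      by rewrite ge0_ler_powR ?nnegrE ?ler_nat// ltW.
    - by move=> n; exact: expR_gt0.
    - move=> n /arc_le n1; have n0 : 0 < n.+1%:R / kap by rewrite divr_gt0// ltr0n.
      rewrite -expRN; have := @expR_arc R (-1) c (n.+1%:R / kap) n0.
      rewrite mulN1r opprK => ->; last first.
        rewrite /radicand mulN1r subr_ge0 expr_le1// ?powR_ge0// ltW//.
        by apply: powR_lt1 => //; exact: ltW.
      rewrite yE /power_coef !powRM ?invr_ge0 ?ltW// -(powR_inv1 (ltW k0)) powRAC powR_inv1 ?powR_ge0//.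
      by field; rewrite !gt_eqF ?powR_gt0.
    move=> n nK; rewrite ler_expR; apply: (arc_nincr c0' m0 hm).
    - by rewrite divr_gt0// ltr0n.
    - by rewrite ler_pM2r ?invr_gt0// ler_nat.
    - rewrite (le_trans _ (ltW sb))// (le_trans _ Kk)//.
      by rewrite ler_pM2r ?invr_gt0// ler_nat leqW.
  rewrite -expR_sum ler_expR.
  apply: le_trans (sum_arc_ge c0' m0 hm k0 (le_lt_trans Kk sb)).
  have H1 := Gam_subr_le Kk0 Kk sb.
  have H2 : Gam kap^-1 <= M * kap^-1.
    by apply: Gam_le; [rewrite invr_ge0 ltW|exact: le_trans ik (ltW sb)].
  have H3 := arcN1_inv_le k0.
  have H4 : 0 <= arc (-1) c (K.+1%:R / kap).
    by apply: arc_ge0 => //; exact: le_trans Kk (ltW s11).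
  have H5 : kap * (s1 - K.+1%:R / kap) <= 1.
    rewrite mulrBr mulrCA mulfV ?gt_eqF// mulr1 [kap * s1]mulrC.
    by rewrite lerBlDr nat1r ltW.
  have M0 : 0 <= M by rewrite invr_ge0 sqrtr_ge0.
  by rewrite div1r; exact: (lower_exponent_le c0 k0 Kk0 M0 (mulfV (lt0r_neq0 k0)) H1 H2 H3 H4 H5).
move=> x /lower H.
have -> : (orthopoly (power_coef c) K).[x] ^+ 2 = (orthopoly (power_coef c) K).[`|x|] ^+ 2.
  have [x0|x0] := leP 0 x; first by rewrite ger0_norm.
  by rewrite ltr0_norm// orthopoly_horner_opp exprMn sqrr_sign mul1r.
by rewrite mulrC -[2]/(2%:R) expRM_natr lerXn2r// nnegrE ?expR_ge0// (le_trans _ H)// expR_ge0.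
Qed.

End PowerLowerBound.

(** * Weighted sums of powers at a fixed point *)

Section PointwiseBound.
Context {R : realType} (c A C1 : R) (a : nat -> R).
Context (hc : 3 / 2 < c) (C10 : 0 <= C1).
Context (a_le : forall kap l, 1 <= kap ->
  a l <= C1 * expR (2 * arc 1 c kap^-1 + kap * A) / (2 * (c * kap) `^ c) ^+ l).
Implicit Types (x kap lam q B d : R) (l m n K N : nat).

Let c0 : 0 < c. Proof. by apply: lt_trans hc; lra. Qed.

Lemma sum_geometric_le q N : 0 <= q -> q < 1 -> \sum_(l < N) q ^+ l <= (1 - q)^-1.
Proof.
move=> q0 q1; have d : 0 < 1 - q by rewrite subr_gt0.
rewrite -[leRHS]mul1r ler_pdivlMr// mulrC -[1 - q]opprB mulNr -subrX1 opprB.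
by rewrite gerBl exprn_ge0.
Qed.

(** Using [a_le] at [lam * kap] instead of [kap] gains the geometric factor [lam^(- c * l)], at the
    price of [lam] in the exponent. The logarithm collects [2 * c] from the two [arc] terms and
    [c * m] from the shift by [m]. *)
Lemma sum_weights_le lam m : 1 < lam -> exists2 C, 0 <= C & forall kap N, 1 <= kap ->
  \sum_(l < N) a l * (2 * (c * kap) `^ c) ^+ (l + m) <=
  C * expR ((2 * c + c * m%:R) * ln kap + lam * A * kap).
Proof.
move=> lam1; have lam0 : 0 < lam by exact: lt_trans lam1.
pose q := (lam `^ c)^-1.
have q0 : 0 < q by rewrite invr_gt0 powR_gt0.
have q1 : q < 1.
  rewrite invf_lt1 ?powR_gt0// -[ltLHS](powRr0 lam) /powR gt_eqF// ltr_expR.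
  by rewrite ltr_pM2r// ln_gt0.
pose C := C1 * expR (2 * ln 3 + 2 * c * ln lam) * (2 * c `^ c) ^+ m * (1 - q)^-1.
exists C; first by rewrite !mulr_ge0 ?expR_ge0 ?exprn_ge0 ?mulr_ge0 ?powR_ge0// invr_ge0 subr_ge0 ltW.
move=> kap N k1; have k0 : 0 < kap by exact: lt_le_trans k1.
have lk1 : 1 <= lam * kap by rewrite -[leLHS]mulr1 ler_pM// ltW.
set y := 2 * (c * kap) `^ c.
have y0 : 0 < y by rewrite mulr_gt0// powR_gt0// mulr_gt0.
have yE : 2 * (c * (lam * kap)) `^ c = y / q.
  rewrite /y /q invrK (mulrCA c) (powRM _ (ltW lam0) (mulr_ge0 (ltW c0) (ltW k0))).
  by ring.
pose E := expR (2 * ln 3 + 2 * c * ln lam) * expR (2 * c * ln kap + lam * A * kap).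
have term l : a l * y ^+ (l + m) <= C1 * E * y ^+ m * q ^+ l.
  have yl : 0 < y ^+ l by rewrite exprn_gt0.
  have H : a l <= C1 * E / (y / q) ^+ l.
    rewrite -yE; apply: le_trans (a_le l lk1) _.
    rewrite ler_wpM2r ?invr_ge0 ?exprn_ge0 ?mulr_ge0 ?powR_ge0//.
    rewrite ler_wpM2l// /E -expRD ler_expR.
    have := arc1_inv_le hc lk1; rewrite lnM ?posrE//.
    move: (ln _) (ln _) (ln _) (arc _ _ _) => l3 ll lk ar; lra.
  rewrite exprD mulrA.
  have -> : C1 * E * y ^+ m * q ^+ l = C1 * E / (y / q) ^+ l * y ^+ l * y ^+ m.
    by rewrite expr_div_n; field; rewrite !gt_eqF ?exprn_gt0.
  by apply: ler_wpM2r; [exact/exprn_ge0/ltW|apply: ler_wpM2r => //; exact: ltW].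
apply: (@le_trans _ _ (\sum_(l < N) C1 * E * y ^+ m * q ^+ l)).
  by apply: ler_sum => l _; exact: term.
have CE0 : 0 <= C1 * E * y ^+ m by rewrite !mulr_ge0 ?expR_ge0 ?exprn_ge0// ltW.
rewrite -mulr_sumr; apply: le_trans (ler_wpM2l CE0 (sum_geometric_le N (ltW q0) q1)) _.
have -> : y ^+ m = (2 * c `^ c) ^+ m * expR (c * m%:R * ln kap).
  rewrite /y powRM ?ltW// mulrA exprMn; congr (_ * _).
  by rewrite [kap `^ c]/powR gt_eqF// -expRM_natl; congr expR; rewrite mulrA (mulrC c).
rewrite (mulrDl (2 * c)) addrAC (expRD (_ + _) (c * _ * _)) /C /E.
rewrite le_eqVlt; apply/orP; left; apply/eqP.
move: (expR _) (expR _) (expR _) (_ ^+ m) (_^-1) => e1 e2 e3 Y Q; ring.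
Qed.

End PointwiseBound.

(** * Domination of the weighted sum by one squared orthonormal polynomial *)

Section Domination.
Context {R : realType} (c A C1 s1 : R) (a : nat -> R).
Context (hc : 3 / 2 < c) (a0 : forall l, 0 <= a l) (C10 : 0 <= C1)
  (a_le : forall kap l, 1 <= kap ->
    a l <= C1 * expR (2 * arc 1 c kap^-1 + kap * A) / (2 * (c * kap) `^ c) ^+ l)
  (s10 : 0 < s1) (s11 : s1 < 1) (A0 : 0 <= A)
  (A_lt : A < 2 * (c * primitive (kern (-1) c) s1)).

Let c0 : 0 < c. Proof. by apply: lt_trans hc; lra. Qed.

Let g := c * primitive (kern (-1) c) s1.

Let exists_lam : exists2 lam, 1 < lam & lam * A < 2 * g.
Proof.
(* The factor [1 + e] uses less than half of the margin; [A + 1] keeps the denominator positive when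
   [A = 0]. *)
pose e := (2 * g - A) / (2 * (A + 1)).
have gA : 0 < 2 * g - A by rewrite subr_gt0.
have A1 : 0 < A + 1 by rewrite ltr_wpDl.
have e0 : 0 < e by rewrite divr_gt0// mulr_gt0.
exists (1 + e); first by rewrite ltrDl.
have -> : (1 + e) * A = A + (2 * g - A) / 2 - e.
  by rewrite /e; field; rewrite gt_eqF.
move: (2 * g) gA e e0 => G gA e e0; lra.
Qed.

(** With [lk = ln k] and [L = ln d], the bound [ln (d * k) <= d * k] lets the linear surplus
    [d * T * k] pay for all logarithms. *)
Let exponent_le (T B d L k lk C : R) : 0 < T -> lk <= d * k - L -> d * T = 2 * g - B ->
  (T - 2 * c - 2) * lk + B * k <= 2 * C - T * L + (- 2 * lk + 2 * (k * g - C - c * lk)).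
Proof.
move=> T0 /(ler_wpM2l (ltW T0)) H E.
have -> : B = 2 * g - d * T by rewrite E; ring.
have E1 : T * (d * k - L) = d * T * k - T * L by ring.
have E2 : (T - 2 * c - 2) * lk + (2 * g - d * T) * k =
  T * lk - 2 * (c * lk) - 2 * lk + 2 * (k * g) - d * T * k by ring.
rewrite E1 in H; rewrite E2; move: H.
move: (T * lk) (d * T * k) (T * L) (c * lk) (k * g) => u v w x y; lra.
Qed.

Lemma sum_le_weighted_sqr m : exists2 C, 0 <= C & forall x, exists K, forall N,
  \sum_(l < N) a l * `|x| ^+ (l + m) <=
  C * (K.+1%:R `^ (- 2) * (orthopoly (power_coef c) K).[x] ^+ 2).
Proof.
have [lam lam1 lamA] := exists_lam.
have [C3 C30 H3] := sum_weights_le hc C10 a_le m lam1.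
have [C2 H2] := orthopoly_lower hc s10 s11.
(* The logarithmic costs: [2 * c + c * m] from the upper bound, [2 * c] from the squared lower
   bound, 2 from the weight. *)
pose T := 2 * c + c * m%:R + 2 * c + 2.
have T0 : 0 < T by rewrite ltr_wpDl ?ltr0n// !addr_ge0 ?mulr_ge0 ?(ltW c0)//.
pose d := (2 * g - lam * A) / T.
have d0 : 0 < d by rewrite divr_gt0// subr_gt0.
have dT : d * T = 2 * g - lam * A by rewrite divfK// gt_eqF.
pose k0 := s1^-1.
have k00 : 0 < k0 by rewrite invr_gt0.
have k01 : 1 <= k0 by rewrite invf_ge1// ltW.
pose x0 := 2 * (c * k0) `^ c.
have x00 : 0 < x0 by rewrite mulr_gt0// powR_gt0// mulr_gt0.
pose C4 := C3 * expR ((2 * c + c * m%:R) * ln k0 + lam * A * k0).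
pose C5 := C3 * expR (2 * C2 - T * ln d).
have C40 : 0 <= C4 by rewrite mulr_ge0 ?expR_ge0.
have C50 : 0 <= C5 by rewrite mulr_ge0 ?expR_ge0.
exists (C4 + C5); first exact: addr_ge0.
(* For small [|x|] the polynomial [P_0 = 1] suffices; the threshold corresponds to the least [kap]
   that [orthopoly_lower] admits. *)
move=> x; have [xx0|/ltW xx0] := leP `|x| x0.
  exists 0%N => N; rewrite orthopoly0 hornerC powR1 expr1n !mulr1.
  apply: (@le_trans _ _ C4); last by rewrite lerDl.
  apply: le_trans (H3 k0 N k01); apply: ler_sum => l _.
  by apply: ler_wpM2l => //; apply: lerXn2r; rewrite ?nnegrE// ltW.
pose k := (`|x| / 2) `^ c^-1 / c.
have kE : `|x| = 2 * (c * k) `^ c.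
  rewrite /k mulrCA mulfV ?gt_eqF// mulr1 -powRrM mulVf ?gt_eqF// powRr1 ?divr_ge0//.
  by rewrite mulrCA mulfV// mulr1.
have k0k : k0 <= k.
  rewrite /k ler_pdivlMr// mulrC.
  have -> : c * k0 = ((c * k0) `^ c) `^ c^-1.
    by rewrite -powRrM mulfV ?gt_eqF// powRr1// mulr_ge0// ltW.
  rewrite ge0_ler_powR ?nnegrE ?powR_ge0 ?invr_ge0 ?divr_ge0 ?(ltW c0)//.
  by rewrite ler_pdivlMr// mulrC.
have kpos : 0 < k by exact: lt_le_trans k0k.
have [K Kk HK] := H2 k k0k.
exists K => N; rewrite [in leLHS]kE.
apply: le_trans (H3 k N (le_trans k01 k0k)) _.
apply: (@le_trans _ _ (C5 * (K.+1%:R `^ (- 2) * (orthopoly (power_coef c) K).[x] ^+ 2))); last first.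
  by apply: ler_wpM2r; [rewrite mulr_ge0 ?powR_ge0 ?sqr_ge0|rewrite lerDr].
rewrite /C5 -(mulrA C3); apply: ler_wpM2l => //.
apply: (@le_trans _ _ (expR (2 * C2 - T * ln d) * (expR (- 2 * ln k) *
   expR (2 * (k * g - C2 - c * ln k))))); last first.
  apply: ler_wpM2l; first exact: expR_ge0.
  apply: ler_pM; rewrite ?expR_ge0//; last exact: HK.
  have -> : expR (- 2 * ln k) = k `^ (- 2) by rewrite /powR gt_eqF.
  by apply: le0_ler_powR => //; rewrite ltr0n.
rewrite -!expRD ler_expR.
have -> : 2 * c + c * m%:R = T - 2 * c - 2.
  by rewrite /T; move: (c * m%:R) => u; ring.
apply: (@exponent_le T (lam * A) d (ln d)) => //.
by rewrite lerBrDr addrC -lnM ?posrE// ltW// ln_sublinear// mulr_gt0.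
Qed.

End Domination.

(** * Integration of the pointwise bound *)

Section MomentSums.
Context {R : realType}.
Implicit Types (b : nat -> R) (mu : probability (measurableTypeR R) R).

Lemma integral_sqr_orthopoly b mu k : orthonormal_measure b mu ->
  (\int[mu]_x ((orthopoly b k).[x] ^+ 2)%:E = 1)%E.
Proof.
move=> [_ /(_ k k)]; rewrite eqxx /Rintegral.
under eq_integral do rewrite -expr2.
have : (0 <= \int[mu]_x ((orthopoly b k).[x] ^+ 2)%:E)%E.
  by apply: integral_ge0 => x _; rewrite lee_fin sqr_ge0.
(* [Rintegral] sends an infinite integral to 0, so the value 1 excludes infinity. *)
case: (\int[mu]_x _)%E => [r _ /= ->//| |//] _ /= /esym/eqP.
by rewrite oner_eq0.
Qed.

Lemma normr_moment_le b mu n : orthonormal_measure b mu ->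
  (`|moment mu n|%:E <= \int[mu]_x (`|x| ^+ n)%:E)%E.
Proof.
move=> [/(_ n) xn _]; rewrite -abse_EFin /moment /Rintegral fineK; last first.
  exact: integrable_fin_num xn.
apply: le_trans (le_abse_integral mu measurableT (measurable_int mu xn)) _.
by under eq_integral do rewrite abse_EFin normrX.
Qed.

(** The index [k] may depend on [x] in any manner: the single term is bounded by the whole series
    over [k], which is measurable and integrates termwise. *)
Lemma weighted_moment_sum_fin b mu (a : nat -> R) m (C : R) (w : nat -> R) (W : R) :
  orthonormal_measure b mu -> (forall l, 0 <= a l) -> 0 <= C ->
  (forall k, 0 <= w k) -> (forall n, \sum_(k < n) w k <= W) ->
  (forall x, exists k, forall N, \sum_(l < N) a l * `|x| ^+ (l + m) <=
     C * (w k * (orthopoly b k).[x] ^+ 2)) ->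
  (\sum_(0 <= l <oo) ((a l)%:E * `|moment mu (l + m)|%:E) <= (C * W)%:E)%E.
Proof.
move=> ob a0 C0 w0 wW aC.
have meas (p : {poly R}) (k : R) : measurable_fun [set: measurableTypeR R]
    (fun x => (k * p.[x] ^+ 2)%:E).
  apply/measurable_EFinP; apply: measurable_funM => //; apply: measurable_funX.
  exact: measurable_poly.
have measX n (k : R) : measurable_fun [set: measurableTypeR R] (fun x => (k * `|x| ^+ n)%:E).
  apply/measurable_EFinP; apply: measurable_funM => //; apply: measurable_funX.
  exact: normr_measurable.
pose f k (x : R) := (C * w k * (orthopoly b k).[x] ^+ 2)%:E.
have f0 k x : (0 <= f k x)%E by rewrite lee_fin mulr_ge0 ?sqr_ge0 ?mulr_ge0.
have intf k : (\int[mu]_x f k x = (C * w k)%:E)%E.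
  rewrite /f; under eq_integral do rewrite EFinM.
  rewrite ge0_integralZl_EFin ?mulr_ge0//.
  - by rewrite (integral_sqr_orthopoly k ob) mule1.
  - by move=> x _; rewrite lee_fin sqr_ge0.
  - by under eq_fun do rewrite -[_ ^+ 2]mul1r; exact: meas.
have sumf : (\int[mu]_x \sum_(0 <= k <oo) f k x <= (C * W)%:E)%E.
  rewrite integral_nneseries//; last by move=> k; exact: meas.
  under eq_eseriesr do rewrite intf.
  apply: nneseries_le => n; first by rewrite lee_fin mulr_ge0.
  by rewrite sumEFin lee_fin -mulr_sumr ler_wpM2l// big_mkord.
apply: nneseries_le => N; first by rewrite mule_ge0 ?lee_fin.
apply: le_trans sumf.
apply: (@le_trans _ _ (\sum_(0 <= l < N) \int[mu]_x (a l * `|x| ^+ (l + m))%:E)%E).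
  apply: lee_sum => l _; under eq_integral do rewrite EFinM.
  rewrite ge0_integralZl_EFin//.
  - by rewrite lee_wpmul2l ?lee_fin// (normr_moment_le _ ob).
  - by under eq_fun do rewrite -[_ ^+ _]mul1r; exact: measX.
rewrite -ge0_integral_sum//; last by move=> l x _; rewrite lee_fin mulr_ge0.
apply: ge0_le_integral => //.
- by move=> x _; apply: sume_ge0 => l _; rewrite lee_fin mulr_ge0.
- by apply: emeasurable_sum => l; exact: measX.
- by apply: ge0_emeasurable_sum => // k *; exact: meas.
move=> x _; have [k /(_ N) H] := aC x.
apply: (@le_trans _ _ (f k x)).
  by rewrite sumEFin lee_fin big_mkord -mulrA.
apply: le_trans (nneseries_lim_ge k.+1 _) => //.
by rewrite big_nat_recr//= leeDr// sume_ge0.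
Qed.

End MomentSums.

Theorem theorem7p4 (R : realType) (c : R) (hc : 3%:R / 2%:R < c) :
  property_cs_star (power_coef c).
Proof.
move=> mu ob m.
have c0 : 0 < c by apply: lt_trans hc; rewrite divr_gt0.
have c1 : 1 < c by apply: lt_trans hc; lra.
have [s1 [s10 s11 [A A_lt FA]]] := arc_prim1_lt_Gam hc.
have A0 : 0 <= A by apply: le_trans (FA 1 ltr01); exact: arc_prim1_ge0.
pose C1 := Num.sqrt (2 `^ c * (1 + (c - 1)^-1)).
(* Finiteness needs only one admissible parameter, here [kap = 1]; the real-valued bound below keeps
   [kap] free. *)
have fin l : coef_norm (power_coef c) l \is a fin_num.
  rewrite ge0_fin_numE ?sqrte_ge0//.
  exact: le_lt_trans (coef_norm_le c0 (lexx 1) l c1 FA) (ltry _).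
pose a l := fine (coef_norm (power_coef c) l).
have a0 l : 0 <= a l by rewrite fine_ge0// sqrte_ge0.
have a_le kap l : 1 <= kap ->
    a l <= C1 * expR (2 * arc 1 c kap^-1 + kap * A) / (2 * (c * kap) `^ c) ^+ l.
  by move=> k1; rewrite -lee_fin fineK//; exact: coef_norm_le.
have [C C0 H] := sum_le_weighted_sqr hc a0 (sqrtr_ge0 _) a_le s10 s11 A0 A_lt m.
apply: (@le_lt_trans _ _ (C * (1 + (2 - 1)^-1))%:E); last exact: ltry.
under eq_eseriesr do rewrite -(fineK (fin _)).
apply: (weighted_moment_sum_fin ob a0 C0 _ _ H).
  by move=> k; exact: powR_ge0.
by apply: le_sum_powRN; rewrite ltr1n.
Qed.
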